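(* Let $1\le k\le n-1$. The noncrossing complex $\Delta^{NC}_{k,n}$ is a flag, regular, unimodular triangulation of the order polytope $\mathcal{O}_{k,n}$, and it is Gorenstein, i.e. as a simplicial complex it is the join of a simplex with a simplicial complex homeomorphic to a sphere (with the convention that the empty complex is the $(-1)$-sphere). In particular, $\Delta^{NC}_{k,n}$ and $\Delta^{NN}_{k,n}$ have the same $f$-vector and the same $h$-vector.
   Context: Let $[n]=\{1,\dots,n\}$. $V_{k,n}$ denotes the set of integer vectors $I=(i_1,\dots,i_k)$ with $1\le i_1<\dots<i_k\le n$ (identified with $k$-subsets of $[n]$). Two arcs $(p<p')$ and $(q<q')$ cross if $p<q<p'<q'$ or $q<p<q'<p'$; they nest if $p<q<q'<p'$ or $q<p<p'<q'$. Two vectors $I=(i_1,\dots,i_k)$, $J=(j_1,\dots,j_k)\in V_{k,n}$ are noncrossing if for all indices $1\le a<b\le k$ such that $i_\ell=j_\ell$ for all $a<\ell<b$, the arcs $(i_a<i_b)$ and $(j_a<j_b)$ do not cross; they are nonnesting if for all $1\le a<b\le k$ the arcs $(i_a<i_b)$ and $(j_a<j_b)$ do not nest (equivalently, $I\le J$ or $J\le I$ componentwise). The noncrossing complex $\Delta^{NC}_{k,n}$ (resp. nonnesting complex $\Delta^{NN}_{k,n}$) is the flag simplicial complex with vertex set $V_{k,n}$ whose faces are the sets of pairwise noncrossing (resp. pairwise nonnesting) vectors. Let $P_{k,n}=\{(a,b): a\in[k], b\in[n-k]\}$. For $I\in V_{k,n}$ let $\chi_I\in\{0,1\}^{P_{k,n}}$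 be given by $(\chi_I)_{a,b}=1$ iff $i_a\le a+b-1$. The order polytope is $\mathcal{O}_{k,n}=\{x\in[0,1]^{P_{k,n}}: x_{a,b}\le x_{a,b+1},\ x_{a+1,b}\le x_{a,b}\}$; its vertices are exactly the points $\chi_I$, $I\in V_{k,n}$ (it is the order polytope of the product of a $k$-chain and an $(n-k)$-chain). A simplicial complex $\Delta$ on vertex set $V_{k,n}$ is a triangulation of $\mathcal{O}_{k,n}$ if for every face $\sigma$ the points $\chi_I$, $I\in\sigma$, are affinely independent, and the simplices $\mathrm{conv}\{\chi_I:I\in\sigma\}$ cover $\mathcal{O}_{k,n}$ and pairwise intersect in common faces. It is unimodular if every maximal simplex has Euclidean volume $1/(k(n-k))!$ (i.e. is a lattice basis simplex for $\mathbb{Z}^{P_{k,n}}$), and regular if there is $w:V_{k,n}\to\mathbb{R}$ such that the simplices of $\Delta$ are exactly the projections of the lower faces of $\mathrm{conv}\{(\chi_I,w(I))\}$. A flag complex is the clique complex of its 1-skeleton. *)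

(* Defs.v *)
From HB Require Import structures.
From mathcomp Require Import all_boot all_order all_algebra.
From Stdlib Require Import Reals.
Set Implicit Arguments. Unset Strict Implicit. Unset Printing Implicit Defensive.

Section Complexes.
Variable V : finType.

Definition complex := {set V} -> bool.

Definition is_simplicial_complex_on (D : complex) : Prop :=
  (forall s t : {set V}, t \subset s -> D s -> D t) /\ (forall v : V, D [set v]).

Definition is_flag (D : complex) : Prop :=
  forall s : {set V}, D s <-> (forall v w, v \in s -> w \in s -> D [set v; w]).

Definition is_maximal_face (D : complex) (s : {set V}) : Prop :=
  D s /\ forall t : {set V}, D t -> s \subset t -> t = s.

(* f-vector, indexed by cardinality: fvec D i = number of faces with i
   elements (= f_{i-1} in the usual notation). *)
Definition fvec (D : complex) (i : nat) : nat :=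
  #|[set s : {set V} | D s & #|s| == i]|.

(* d = dim + 1 = maximal cardinality of a face *)
Definition cdim (D : complex) : nat := \max_(s : {set V} | D s) #|s|.

Local Open Scope ring_scope.
Definition hvec (D : complex) (j : nat) : int :=
  \sum_(i < j.+1) (-1) ^+ (j - i) * ('C(cdim D - i, j - i))%:Z * (fvec D i)%:Z.

End Complexes.

Section Geometry.
Local Open Scope R_scope.

Definition rsum {T : finType} (f : T -> R) : R := \big[Rplus/R0]_(i : T) f i.

(* sup-distance on R^T (equivalent to the Euclidean one, T finite) *)
Definition rdist {T : finType} (x y : T -> R) : R :=
  \big[Rmax/R0]_(i : T) Rabs (x i - y i).

Definition continuous_on {T U : finType} (X : (T -> R) -> Prop)
  (f : (T -> R) -> (U -> R)) : Prop :=
  forall x, X x -> forall eps, 0 < eps -> exists delta, 0 < delta /\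
    forall y, X y -> rdist x y < delta -> rdist (f x) (f y) < eps.

Definition homeomorphic {T U : finType} (X : (T -> R) -> Prop)
  (Y : (U -> R) -> Prop) : Prop :=
  exists (f : (T -> R) -> (U -> R)) (g : (U -> R) -> (T -> R)),
    (forall x, X x -> Y (f x)) /\ (forall y, Y y -> X (g y)) /\
    (forall x, X x -> forall i, g (f x) i = x i) /\
    (forall y, Y y -> forall i, f (g y) i = y i) /\
    continuous_on X f /\ continuous_on Y g.

(* unit sphere in R^m, i.e. the (m-1)-sphere; m = 0 gives the empty set,
   the (-1)-sphere *)
Definition sphere (m : nat) : ('I_m -> R) -> Prop :=
  fun y => rsum (fun i => y i * y i) = 1.

Definition realization {V : finType} (G : complex V) : (V -> R) -> Prop :=
  fun x => (forall v, 0 <= x v) /\ rsum x = 1 /\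
    exists s : {set V}, G s /\ forall v, v \notin s -> x v = 0.

Definition homeomorphic_to_sphere {V : finType} (G : complex V) : Prop :=
  exists m : nat, homeomorphic (realization G) (@sphere m).

Definition is_Gorenstein {V : finType} (D : complex V) : Prop :=
  exists (A : {set V}) (G : complex V),
    (forall s t : {set V}, t \subset s -> G s -> G t) /\
    (forall r, G r -> [disjoint A & r]) /\
    (forall s, D s <-> exists t r : {set V}, t \subset A /\ G r /\ s = t :|: r) /\
    homeomorphic_to_sphere G.

Section PointConfig.
Variables (V P : finType) (pt : V -> P -> R).

Definition in_conv (s : {set V}) (x : P -> R) : Prop :=
  exists lam : V -> R, (forall v, 0 <= lam v) /\ (forall v, v \notin s -> lam v = 0) /\
    rsum lam = 1 /\ forall p, x p = rsum (fun v => lam v * pt v p).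

Definition aff_indep (s : {set V}) : Prop :=
  forall lam : V -> R, (forall v, v \notin s -> lam v = 0) -> rsum lam = 0 ->
    (forall p, rsum (fun v => lam v * pt v p) = 0) -> forall v, lam v = 0.

Definition is_triangulation (D : complex V) (Q : (P -> R) -> Prop) : Prop :=
  (forall s, D s -> aff_indep s) /\
  (forall s x, D s -> in_conv s x -> Q x) /\
  (forall x, Q x -> exists s, D s /\ in_conv s x) /\
  (forall s t x, D s -> D t -> in_conv s x -> in_conv t x -> in_conv (s :&: t) x).

(* regular: there is a height function w such that the faces of D are
   exactly the point sets of the lower faces of conv{(pt v, w v)}, a lower
   face being cut out by a non-vertical hyperplane x_{n+1} = c.x + c0 lying
   weakly below all lifted points *)
Definition is_regular (D : complex V) : Prop :=
  exists w : V -> R, forall s : {set V}, D s <->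
    exists (c : P -> R) (c0 : R), forall v,
      c0 + rsum (fun p => c p * pt v p) <= w v /\
      (v \in s <-> c0 + rsum (fun p => c p * pt v p) = w v).

End PointConfig.
End Geometry.

Section NCNN.
Variables k n : nat.

(* V_{k,n}: strictly increasing k-vectors with entries in [n]; entries are
   stored 0-based in 'I_n, and [entry I a] returns the 1-based value i_{a+1} *)
Definition Vkn : finType :=
  {t : k.-tuple 'I_n | sorted (fun x y : 'I_n => (x < y)%N) t}.

Definition entry (I : Vkn) (a : 'I_k) : nat := (val (tnth (val I) a)).+1.

Definition crossing (p p' q q' : nat) : bool :=
  [&& p < q, q < p' & p' < q']%N || [&& q < p, p < q' & q' < p']%N.

Definition nesting (p p' q q' : nat) : bool :=
  [&& p < q, q < q' & q' < p']%N || [&& q < p, p < p' & p' < q']%N.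

Definition noncrossing (I J : Vkn) : bool :=
  [forall a : 'I_k, forall b : 'I_k,
     ((a < b)%N && [forall l : 'I_k, ((a < l) && (l < b))%N ==> (entry I l == entry J l)])
     ==> ~~ crossing (entry I a) (entry I b) (entry J a) (entry J b)].

Definition nonnesting (I J : Vkn) : bool :=
  [forall a : 'I_k, forall b : 'I_k,
     (a < b)%N ==> ~~ nesting (entry I a) (entry I b) (entry J a) (entry J b)].

Definition NC : complex Vkn :=
  fun s => [forall I in s, forall J in s, noncrossing I J].

Definition NN : complex Vkn :=
  fun s => [forall I in s, forall J in s, nonnesting I J].

(* P_{k,n} = [k] x [n-k], stored 0-based *)
Definition Pkn : finType := ('I_k * 'I_(n - k))%type.

(* (chi_I)_{a,b} = 1 iff i_a <= a + b - 1 (1-based a, b) *)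
Definition chib (I : Vkn) (p : Pkn) : bool :=
  (entry I p.1 <= (p.1).+1 + (p.2).+1 - 1)%N.

Definition chiR (I : Vkn) (p : Pkn) : R := if chib I p then R1 else R0.
Definition chiZ (I : Vkn) (p : Pkn) : int := (chib I p)%:Z.

Definition order_polytope (x : Pkn -> R) : Prop :=
  (forall p, (0 <= x p <= 1)%R) /\
  (forall (a : 'I_k) (b b' : 'I_(n - k)), val b' = (val b).+1 -> (x (a, b) <= x (a, b'))%R) /\
  (forall (a a' : 'I_k) (b : 'I_(n - k)), val a' = (val a).+1 -> (x (a', b) <= x (a, b))%R).

(* unimodular: every maximal simplex has volume 1/(k(n-k))!, i.e. for an
   enumeration I_0,...,I_d of its vertices (d = #|P_{k,n}| = k(n-k)),
   |det (chi_{I_j} - chi_{I_0})_{j=1..d}| = 1 *)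
Local Open Scope ring_scope.
Definition is_unimodular (D : complex Vkn) : Prop :=
  forall s, is_maximal_face D s ->
    exists f : 'I_(#|Pkn|).+1 -> Vkn,
      injective f /\ s = [set f i | i in 'I_(#|Pkn|).+1] /\
      let M := \matrix_(i < #|Pkn|, j < #|Pkn|)
                 (chiZ (f (lift ord0 i)) (enum_val j) - chiZ (f ord0) (enum_val j)) in
      \det M = 1 \/ \det M = -1.

End NCNN.
Arguments NC : clear implicits.
Arguments NN : clear implicits.
Arguments order_polytope : clear implicits.
Arguments chiR : clear implicits.

(* Main.v *)
(** Write chi_I also for the homogenized vertex (chi_I, 1). Two properties of a compatibility
    relation on V_{k,n} drive everything.

    Uniqueness: a nonnegative combination of vertices whose support is pairwise noncrossing is
    determined by its value. The value gives the distribution of each entry; going through the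
    entries from left to right, the coupling of a prefix with the next entry is forced, because
    at the smallest value where two couplings differ some crossing appears. Done with error
    terms, the same argument shows that the coefficients are Lipschitz functions of the value.

    Existence: if I and J cross at (a, b), exchanging their tails from position b on preserves
    chi_I + chi_J and strictly decreases the weight w(I) = sum_{a<b} B^(k-(b-a)) i_a i_b, for B
    large. So minimal-weight representations are noncrossing, over the reals and over the
    natural numbers.

    Together these give the triangulation, and by Farkas' lemma its regularity; the integral
    version gives unimodularity. Both properties also hold for the nonnesting relation (with
    meets and joins in place of the exchange), so the multisets of N vertices with noncrossing,
    resp. nonnesting, support are equinumerous for every N, whence the equality of f-vectors.

    The cyclic intervals are compatible with every vertex, and their chi_I are functions of the
    row only or of the column only. Functions of the form r_a + s_b are the kernel of the mixed
    second difference, a surjection onto R^((k-1)(n-k-1)), which therefore maps the cone over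
    the link of the simplex of cyclic intervals bijectively onto R^((k-1)(n-k-1)); normalizing
    yields a homeomorphism from the link to a sphere. *)

Require Import Defs.
From HB Require Import structures.
From mathcomp Require Import all_boot all_order all_algebra.
From Stdlib Require Import Reals.
From mathcomp Require Import zify ring lra.
From mathcomp Require Import boolp Rstruct.
Set Implicit Arguments.
Unset Strict Implicit.
Unset Printing Implicit Defensive.
Import Order.TTheory GRing.Theory Num.Theory.
#[local] Delimit Scope nat_scope with N.
#[local] Delimit Scope ring_scope with R.
#[local] Bind Scope ring_scope with Rdefinitions.R.

(** * Vectors *)

Section Vectors.
Variables k n : nat.
Local Notation V := (Vkn k n).
Local Notation P := (Pkn k n).
Implicit Types (I J : V) (a b : 'I_k).

(** Zero-based entry, one less than [entry]; crossing and nesting are invariant under this common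
    shift. *)
Definition ent I a : nat := val (tnth (val I) a).

Lemma ent_ltn I a : (ent I a < n)%N.
Proof. exact: ltn_ord. Qed.

Lemma ent_mono I a b : (a < b)%N -> (ent I a < ent I b)%N.
Proof.
move=> ab; have tr : transitive (fun x y : 'I_n => (x < y)%N).
  by move=> y x z; apply: ltn_trans.
have x0 := tnth (val I) a.
rewrite /ent !(tnth_nth x0).
apply: (sorted_ltn_nth tr x0 (valP I)) => //; rewrite inE size_tuple //.
Qed.

Lemma ent_mono_le I a b : (a <= b)%N -> (ent I a <= ent I b)%N.
Proof.
rewrite leq_eqVlt => /orP[/eqP/val_inj->//|/(ent_mono I)/ltnW//].
Qed.

Lemma ent_inj I J : (forall a, ent I a = ent J a) -> I = J.
Proof. by move=> h; apply/val_inj/eq_from_tnth => a; apply/val_inj/h. Qed.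

Lemma ent_gap I a b : (a <= b)%N -> (ent I a + (b - a) <= ent I b)%N.
Proof.
case: a b => a ha [b hb] /=; elim: b hb => [|b IH] hb.
  rewrite leqn0 => /eqP a0; subst a.
  by rewrite subnn addn0; apply: ent_mono_le.
rewrite leq_eqVlt => /orP[/eqP ab|ab].
  by subst a; rewrite subnn addn0; apply: ent_mono_le.
have hb' : (b < k)%N by apply: ltnW.
have := IH hb' ab; have := @ent_mono I (Ordinal hb') (Ordinal hb) (ltnSn b).
lia.
Qed.

Lemma ent_ge I a : (a <= ent I a)%N.
Proof.
have k0 : (0 < k)%N by apply: leq_ltn_trans (ltn_ord a).
by have := @ent_gap I (Ordinal k0) a (leq0n a); rewrite /=; lia.
Qed.

Lemma ent_le I a : (ent I a <= a + (n - k))%N.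
Proof.
have k0 : (k.-1 < k)%N by move: (ltn_ord a); lia.
have ak : (a <= Ordinal k0)%N by move: (ltn_ord a); rewrite /=; lia.
have := @ent_gap I a (Ordinal k0) ak; have := ent_ltn I (Ordinal k0).
by move: (ltn_ord a); rewrite /=; lia.
Qed.

Lemma vector_of (g : 'I_k -> nat) : (forall a, (g a < n)%N) ->
  (forall a b, (a < b)%N -> (g a < g b)%N) -> exists I, forall a, ent I a = g a.
Proof.
move=> gn gm; pose t := [tuple Ordinal (gn a) | a < k].
have st : sorted (fun x y : 'I_n => (x < y)%N) t.
  apply: pairwise_sorted.
  rewrite pairwise_map; have: pairwise (fun x y : 'I_k => (x < y)%N) (ord_tuple k).
    have := iota_ltn_sorted 0 k; rewrite (sorted_pairwise ltn_trans).
    by rewrite -val_enum_ord pairwise_map.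
  apply: sub_pairwise => a b /=; exact: gm.
by exists (exist _ t st) => a; rewrite /ent /= tnth_map tnth_ord_tuple.
Qed.

Lemma chibE I (a : 'I_k) (b : 'I_(n - k)) : chib I (a, b) = (ent I a <= a + b)%N.
Proof. by rewrite /chib /entry /= -/(ent I a) addnS subn1 /=; lia. Qed.

Lemma noncrossingP I J : reflect (forall a b, (a < b)%N ->
    (forall l : 'I_k, (a < l < b)%N -> ent I l = ent J l) ->
    ~~ ((ent I a < ent J a < ent I b) && (ent I b < ent J b))%N &&
    ~~ ((ent J a < ent I a < ent J b) && (ent J b < ent I b))%N)
  (noncrossing I J).
Proof.
apply: (iffP forallP) => h a.
  move=> b ab hl; have /forallP/(_ b)/implyP := h a.
  rewrite ab /crossing /entry -/(ent I a) -/(ent I b) -/(ent J a) -/(ent J b).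
  rewrite !ltnS -!andbA negb_or; apply.
  by apply/forallP => l; apply/implyP => /hl e; rewrite -/(ent I l) -/(ent J l) e.
apply/forallP => b; apply/implyP => /andP[ab /forallP hl].
have := h a b ab; rewrite /crossing /entry -/(ent I a) -/(ent I b) -/(ent J a) -/(ent J b).
rewrite !ltnS -!andbA negb_or; apply => l /(implyP (hl l)) /eqP.
by rewrite /entry => -[].
Qed.

(** Entries increase along each vector, so nesting of two arcs amounts to their endpoints being
    ordered in opposite ways at [a] and at [b]. *)
Lemma nonnestingP I J : reflect (forall a b, (a < b)%N ->
    ~~ ((ent I a < ent J a) && (ent J b < ent I b))%N &&
    ~~ ((ent J a < ent I a) && (ent I b < ent J b))%N)
  (nonnesting I J).
Proof.
have e a b : (a < b)%N -> 
  ~~ nesting (entry I a) (entry I b) (entry J a) (entry J b) = 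
  ~~ ((ent I a < ent J a) && (ent J b < ent I b))%N &&
    ~~ ((ent J a < ent I a) && (ent I b < ent J b))%N.
  move=> ab; have := ent_mono I ab; have := ent_mono J ab.
  rewrite /nesting /entry -/(ent I a) -/(ent I b) -/(ent J a) -/(ent J b); lia.
apply: (iffP forallP) => h a.
  by move=> b ab; rewrite -e //; have /forallP/(_ b)/implyP := h a; apply.
by apply/forallP => b; apply/implyP => ab; rewrite e //; apply: h.
Qed.

Lemma noncrossing_refl I : noncrossing I I.
Proof. by apply/noncrossingP => a b _ _; rewrite !ltnn. Qed.

Lemma nonnesting_refl I : nonnesting I I.
Proof. by apply/nonnestingP => a b _; rewrite !ltnn. Qed.

(* In the comparison of two measures below, [I] and [K] lie in the support of the first one,
   [J] and [L] in that of the second one. *)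
Definition exchange_free (comp : rel V) := forall (b : 'I_k) I J K L,
  (forall a, (a < b)%N -> ent I a = ent L a) ->
  (forall a, (a < b)%N -> ent J a = ent K a) ->
  ~ (forall a, (a < b)%N -> ent I a = ent J a) ->
  ent I b = ent J b -> (ent I b < ent K b)%N -> (ent I b < ent L b)%N ->
  comp I K -> comp J L -> False.

(** For [a < b], compatibility of [I] with the larger [K] gives [ent I a <= ent K a = ent J a], and
    that of [J] with [L] gives the reverse inequality. *)
Lemma nonnesting_exchange_free : exchange_free (@nonnesting k n).
Proof.
move=> b I J K L IL JK IJ bIJ bK bL /nonnestingP h1 /nonnestingP h2; apply: IJ => a ab.
have := h1 a b ab; have := h2 a b ab; rewrite -(IL a ab) -(JK a ab); lia.
Qed.

(** Let [a] be the last position before [b] where [I] and [J] differ. If [ent I a < ent J a], the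
    arcs of [I] and [K] at [(a, b)] cross; otherwise those of [J] and [L] do. *)
Lemma noncrossing_exchange_free : exchange_free (@noncrossing k n).
Proof.
move=> b I J K L IL JK IJ bIJ bK bL /noncrossingP h1 /noncrossingP h2.
pose D := fun a : nat => [exists a' : 'I_k, [&& a' == a :> nat, (a' < b)%N & ent I a' != ent J a']].
have exD : exists i : nat, D i.
  case: (boolP [exists a' : 'I_k, (a' < b)%N && (ent I a' != ent J a')]).
    by move=> /existsP[a /andP[h h']]; exists a; apply/existsP; exists a; rewrite eqxx h.
  rewrite negb_exists => /forallP h; case: IJ => a ab; apply/eqP.
  by have := h a; rewrite ab /= negbK.
have Dk (i : nat) : D i -> (i <= k)%N by move=> /existsP[a' /andP[/eqP <- _]]; apply: ltnW.
case: (ex_maxnP exD Dk) => _ /existsP[a /and3P[/eqP <- ab nab]] amax.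
have agree (l : 'I_k) : (a < l < b)%N -> ent I l = ent J l.
  move=> /andP[al lb]; apply/eqP; case: eqP => // /eqP ne.
  have : D l by apply/existsP; exists l; rewrite eqxx lb.
  by move/amax; rewrite leqNgt al.
have := h1 a b ab; have := h2 a b ab; rewrite -(IL a ab) -(JK a ab).
move=> H2 H1; have := ent_mono I ab; have := ent_mono J ab => mJ mI.
have {}H1 : ~~ ((ent I a < ent J a < ent I b) && (ent I b < ent K b))%N &&
     ~~ ((ent J a < ent I a < ent K b) && (ent K b < ent I b))%N.
  by apply: H1 => l /[dup] /andP[_ lb] /agree ->; exact: JK.
have {}H2 : ~~ ((ent J a < ent I a < ent J b) && (ent J b < ent L b))%N &&
     ~~ ((ent I a < ent J a < ent L b) && (ent L b < ent J b))%N.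
  by apply: H2 => l /[dup] /andP[_ lb] /agree <-; exact: IL.
lia.
Qed.
End Vectors.

(** * Weight-decreasing exchanges *)

Section Swaps.
Variables k n : nat.
Local Notation V := (Vkn k n).
Implicit Types (I J : V) (a b c d : 'I_k).
Local Open Scope ring_scope.

(** The strict decrease of [w] forces a combination of minimal weight to have compatible support. *)
Definition swappable (comp : rel V) (w : V -> int) := forall I J, ~~ comp I J ->
  exists I' J', (forall p, chib I p + chib J p = chib I' p + chib J' p)%N /\
    w I' + w J' < w I + w J.

(** Row [a] of [chib] depends on entry [a] alone, so only the unordered pair of entries matters in
    each row. *)
Lemma chib_exchange I J I' J' :
  (forall a, ent I' a = ent I a /\ ent J' a = ent J a \/
             ent I' a = ent J a /\ ent J' a = ent I a) ->
  forall p, (chib I p + chib J p = chib I' p + chib J' p)%N.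
Proof.
by move=> h [a b]; rewrite !chibE; case: (h a) => -[-> ->] //; exact: addnC.
Qed.

(** Passing to meet and join keeps the total of the two entry sums but spreads them apart, so
    convexity of the square makes this weight drop. *)
Definition nn_weight I : int := - (\sum_a (ent I a)%:Z) ^+ 2.

Lemma nonnesting_swappable : swappable (@nonnesting k n) nn_weight.
Proof.
move=> I J nIJ.
wlog: I J nIJ / (exists a, exists b, (ent I a < ent J a)%N && (ent J b < ent I b)%N).
  move=> H; have : exists a, exists b, [|| (ent I a < ent J a)%N && (ent J b < ent I b)%N
      | (ent J a < ent I a)%N && (ent I b < ent J b)%N].
    move: nIJ; rewrite /nonnesting negb_forall => /existsP[a].
    rewrite negb_forall => /existsP[b]; rewrite negb_imply negbK /nesting /entry.
    rewrite -/(ent I a) -/(ent I b) -/(ent J a) -/(ent J b) => /andP[ab h].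
    by exists a, b; move: h; lia.
  case=> a [b /orP[] h]; first by apply: H => //; exists a, b.
  case: (H J I); [|by exists a, b|].
    apply: contra nIJ => /nonnestingP h'; apply/nonnestingP => a' b' ab.
    by have := h' a' b' ab; lia.
  move=> I' [J' [h1 h2]]; exists I', J'; split; last by rewrite [X in _ < X]addrC.
  by move=> p; rewrite addnC h1.
case=> a [b /andP[ha hb]].
(* The new pair is the componentwise meet [I'] and join [J']. *)
have [||I' hI'] := @vector_of k n (fun c => minn (ent I c) (ent J c)).
- by move=> c; rewrite gtn_min ent_ltn.
- by move=> c d cd; have := ent_mono I cd; have := ent_mono J cd; lia.
have [||J' hJ'] := @vector_of k n (fun c => maxn (ent I c) (ent J c)).
- by move=> c; rewrite gtn_max !ent_ltn.
- by move=> c d cd; have := ent_mono I cd; have := ent_mono J cd; lia.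
exists I', J'; split; first by apply: chib_exchange => c; rewrite hI' hJ'; lia.
rewrite /nn_weight; set x := \sum_c _; set y := \sum_c _; set z := \sum_c _; set t := \sum_c _.
have e : x + y = z + t.
  by rewrite -!big_split; apply: eq_bigr => c _ /=; rewrite hI' hJ'; lia.
have lt_sum (f g : 'I_k -> int) c : (forall i, f i <= g i) -> f c < g c -> \sum_i f i < \sum_i g i.
  move=> fg lt; rewrite (bigD1 c) //= [X in _ < X](bigD1 c) //=.
  by apply: ltr_leD => //; apply: ler_sum.
have h1 : z < y by apply: (lt_sum _ _ a) => [i|]; rewrite hJ'; lia.
have h2 : t < y by apply: (lt_sum _ _ b) => [i|]; rewrite hJ'; lia.
(* With [x + y = z + t], the drop in weight is [2 (y - z) (y - t)]. *)
have ex : x = z + t - y by rewrite -e addrK.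
rewrite ex -subr_gt0; have := mulr_gt0 (_ : 0 < y - z) (_ : 0 < y - t).
rewrite !subr_gt0 => /(_ h1 h2); nra.
Qed.

(** There are at most [k * k] pairs of positions, and a product of two differences of entries is at
    most [n * n]; hence one term with the top power outweighs all terms with lower powers. *)
Let base : int := (k * k * n * n).+1%:Z.

Definition nc_weight I : int :=
  \sum_(p : 'I_k * 'I_k | (p.1 < p.2)%N)
    base ^+ (k - (p.2 - p.1)) * ((ent I p.1)%:Z * (ent I p.2)%:Z).

(* Exchanging the tails from position [b] on changes the weight by a sum of products
   over pairs [c < b <= d]; the pair [(a, b)] dominates, since the pairs with [c] strictly
   between [a] and [b] contribute nothing and all others carry a smaller power of [base]. *)
Lemma noncrossing_swappable : swappable (@noncrossing k n) nc_weight.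
Proof.
move=> I J nIJ.
wlog: I J nIJ / (exists a, exists b, [/\ (a < b)%N,
    forall l : 'I_k, (a < l < b)%N -> ent I l = ent J l &
    (ent I a < ent J a < ent I b)%N && (ent I b < ent J b)%N]).
  move=> H; move: (nIJ); rewrite /noncrossing negb_forall => /existsP[a].
  rewrite negb_forall => /existsP[b]; rewrite negb_imply negbK.
  case/andP => /andP[ab /forallP hl]; rewrite /crossing /entry.
  have {}hl : forall l : 'I_k, (a < l < b)%N -> ent I l = ent J l.
    by move=> l /(implyP (hl l)) /eqP[].
  rewrite -/(ent I a) -/(ent I b) -/(ent J a) -/(ent J b) !ltnS => /orP[] h.
    by apply: H => //; exists a, b; split=> //; rewrite -andbA.
  case: (H J I).
  - apply: contra nIJ => /noncrossingP h'; apply/noncrossingP => a' b' ab' hl'.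
    rewrite andbC; apply: h' => // l hl2; exact/esym/hl'.
  - by exists a, b; split=> //; [move=> l /hl|rewrite -andbA].
  move=> I' [J' [h1 h2]]; exists I', J'; split; last by rewrite [X in _ < X]addrC.
  by move=> p; rewrite addnC h1.
case=> a [b [ab agree cr]].
(* This keeps both vectors increasing after their tails from [b] on are exchanged: up to [a] it
   comes from the crossing, between [a] and [b] from the agreement. *)
have below c : (c < b)%N -> (ent I c < ent J b)%N /\ (ent J c < ent I b)%N.
  move=> cb; have := ent_mono I cb; have := ent_mono J cb.
  have [ac|ca] := ltnP a c; first by rewrite agree ?ac //; lia.
  by have := ent_mono_le J ca; lia.
have glue (X Y : V) : (ent X b <= ent Y b)%N \/ (forall c, (c < b)%N -> (ent X c < ent Y b)%N) ->
    exists Z : V, forall c, ent Z c = if (c < b)%N then ent X c else ent Y c.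
  move=> h; apply: vector_of => [c|c d cd]; first by case: ifP; rewrite ent_ltn.
  case: ifP => cb; case: ifP => db; [exact: ent_mono| |lia|exact: ent_mono].
  have bd : (b <= d)%N by lia.
  have := ent_mono_le Y bd; case: h => [h|/(_ _ cb)]; last lia.
  by have := ent_mono X cb; lia.
have [I' hI'] : exists Z : V, forall c, ent Z c = if (c < b)%N then ent I c else ent J c.
  by apply: glue; right => c /below[].
have [J' hJ'] : exists Z : V, forall c, ent Z c = if (c < b)%N then ent J c else ent I c.
  by apply: glue; right => c /below[].
exists I', J'; split.
  by apply: chib_exchange => c; rewrite hI' hJ'; case: ifP => _; [left|right].
pose x c : int := (ent I c)%:Z - (ent J c)%:Z.
pose cf (p : 'I_k * 'I_k) : int := base ^+ (k - (p.2 - p.1)).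
pose T (p : 'I_k * 'I_k) := if (p.1 < b <= p.2)%N then cf p * (x p.1 * x p.2) else 0.
have eT : nc_weight I + nc_weight J - (nc_weight I' + nc_weight J') = \sum_p T p.
  rewrite [RHS](bigID (fun p : 'I_k * 'I_k => (p.1 < p.2)%N)) /= [X in _ = _ + X]big1 ?addr0.
    rewrite /nc_weight -!big_split -sumrB; apply: eq_bigr => -[c d] /= cd.
    rewrite !hI' !hJ' /T /cf /x /=.
    case: (ltnP c b) => cb; case: (ltnP d b) => db /=; try ring.
    by exfalso; lia.
  by move=> [c d] /=; rewrite /T /=; case: ifP => // h1 h2; exfalso; lia.
rewrite -subr_gt0 eT.
have [e he] : exists e, (k - (b - a))%N = e.+1 by exists (k - (b - a)).-1; have := ltn_ord b; lia.
pose Q := base ^+ e.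
have base1 : 1 <= base by rewrite /base; lia.
have Q0 : 0 < Q by apply: exprn_gt0; lia.
have xn c : `|x c| <= n%:Z by rewrite /x; have := ent_ltn I c; have := ent_ltn J c; lia.
have Tlow p : p != (a, b) -> 0 <= T p + Q * (n%:Z * n%:Z).
  case: p => c d ne; rewrite /T /cf /=; case: ifP => [/andP[cb bd]|_]; last first.
    by rewrite add0r mulr_ge0 // ltW.
  have [->|ne0] := eqVneq (x c) 0; first by rewrite mul0r mulr0 add0r mulr_ge0 // ltW.
  have ca : (c <= a)%N.
    rewrite leqNgt; apply: contra ne0 => ac; rewrite /x agree ?subrr //; exact/andP.
  have le_e : (k - (d - c) <= e)%N.
    have : ~ ((c == a :> nat) && (d == b :> nat)).
      by move=> /andP[/eqP/val_inj ec /eqP/val_inj ed]; move: ne; rewrite ec ed eqxx.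
    by have := ltn_ord d; lia.
  have cfle : base ^+ (k - (d - c)) <= Q by apply: ler_weXn2l.
  have cf0 : 0 <= base ^+ (k - (d - c)) by apply: exprn_ge0; lia.
  have : `|base ^+ (k - (d - c)) * (x c * x d)| <= Q * (n%:Z * n%:Z).
    by rewrite normrM ger0_norm // normrM; apply: ler_pM => //; apply: ler_pM.
  by rewrite ler_norml => /andP[h _]; lia.
have Tab : Q * base <= T (a, b).
  rewrite /T /= ab leqnn /cf /= he exprSr -/Q -[leLHS]mulr1; apply: ler_wpM2l.
    by apply: mulr_ge0; lia.
  by rewrite /x; nia.
(* After the shift by [Q * n * n] all terms other than [(a, b)] are nonnegative; the [k * k] shifts
   cost [Q * (base - 1)] in total, less than the lower bound [Q * base] for [T (a, b)]. *)
have : T (a, b) + Q * (n%:Z * n%:Z) <= \sum_p (T p + Q * (n%:Z * n%:Z)).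
  by rewrite (bigD1 (a, b)) //= lerDl; apply: sumr_ge0.
rewrite big_split /= sumr_const card_prod card_ord.
rewrite -mulr_natr; set S := \sum_p _ => h.
have : 0 <= Q * (n%:Z * n%:Z) by apply: mulr_ge0; lia.
have eb : base = 1 + (k * k)%:R * (n%:Z * n%:Z) by rewrite /base; lia.
by move: Tab; rewrite eb => Tab h0; nra.
Qed.
End Swaps.

(** * Stability of carried combinations *)

Section Moments.
Variables (F : realFieldType) (k n : nat).
Local Notation V := (Vkn k n).
Local Notation P := (Pkn k n).
Implicit Types (I J : V) (lam mu : V -> F).
Local Open Scope ring_scope.

(* The [None] coordinate homogenizes: it records the total mass. *)
Definition hom I (q : option P) : F := if q is Some p then (chib I p)%:R else 1.

Definition moment lam q : F := \sum_I lam I * hom I q.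

Definition carried (comp : rel V) lam := forall I J, 0 < lam I -> 0 < lam J -> comp I J.

Lemma moment_total lam : moment lam None = \sum_I lam I.
Proof. by apply: eq_bigr => I _; rewrite mulr1. Qed.

Lemma moment_sum (T : finType) (f : T -> F) (g : T -> V -> F) q :
  moment (fun I => \sum_t f t * g t I) q = \sum_t f t * moment (g t) q.
Proof.
rewrite /moment; under eq_bigr do rewrite mulr_suml.
rewrite exchange_big; apply: eq_bigr => t _; rewrite mulr_sumr.
by apply: eq_bigr => I _; rewrite mulrA.
Qed.

Lemma momentD lam mu q : moment (fun I => lam I + mu I) q = moment lam q + moment mu q.
Proof. by rewrite /moment -big_split; apply: eq_bigr => I _; rewrite mulrDl. Qed.

Lemma momentB lam mu q : moment (fun I => lam I - mu I) q = moment lam q - moment mu q.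
Proof. by rewrite /moment -sumrB; apply: eq_bigr => I _; rewrite mulrBl. Qed.

Lemma momentZ c lam q : moment (fun I => c * lam I) q = c * moment lam q.
Proof. by rewrite /moment mulr_sumr; apply: eq_bigr => I _; rewrite mulrA. Qed.

Lemma moment_delta I q : moment (fun J => (J == I)%:R) q = hom I q.
Proof.
rewrite /moment (bigD1 I) //= eqxx mul1r big1 ?addr0 // => J /negPf->.
by rewrite mul0r.
Qed.

Lemma eq_moment lam mu : lam =1 mu -> moment lam =1 moment mu.
Proof. by move=> h q; apply: eq_bigr => I _; rewrite h. Qed.

Lemma sum_gt0_ex (Q : pred V) (f : V -> F) :
  0 < \sum_(I | Q I) f I -> exists2 I, Q I & 0 < f I.
Proof.
move=> h; apply/exists_inP; apply: contraTT h; rewrite negb_exists => /forallP h.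
rewrite -leNgt; apply: sumr_le0 => I QI; have := h I; rewrite QI /=.
by rewrite -leNgt.
Qed.

Section Comparison.
Variable comp : rel V.
Hypothesis comp_exchange : exchange_free comp.

(** The hypotheses of the comparison with an error term: [eta = 0] yields uniqueness, general [eta]
    the Lipschitz bound. *)
Definition near lam mu (eta : F) :=
  [/\ forall I, 0 <= lam I, forall I, 0 <= mu I, carried comp lam, carried comp mu
    & forall q, `|moment lam q - moment mu q| <= eta].

Lemma near_sym lam mu eta : near lam mu eta -> near mu lam eta.
Proof. by move=> [h1 h2 h3 h4 h5]; split=> // q; rewrite distrC. Qed.

Let diff lam mu (Q : pred V) : F := \sum_(I | Q I) (lam I - mu I).

Lemma diff_sym lam mu Q : diff lam mu Q = - diff mu lam Q.
Proof. by rewrite /diff -sumrN; apply: eq_bigr => I _; rewrite opprB. Qed.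

Lemma near_ge0 lam mu eta : near lam mu eta -> 0 <= eta.
Proof. by case=> _ _ _ _ /(_ None); apply: le_trans. Qed.

(** The coordinate [(a, c - 1 - a)] of the moment is exactly the mass of [ent I a < c]; outside the
    range of columns this mass is zero or the total mass. *)
Lemma diff_column lam mu eta (a : 'I_k) c : near lam mu eta ->
  `|diff lam mu (fun I => (ent I a < c)%N)| <= eta.
Proof.
move=> nr; have eta0 := near_ge0 nr; case: nr => _ _ _ _ nr.
have [ca|ac] := leqP c a.
  rewrite /diff big_pred0 ?normr0 // => I; apply/negbTE; rewrite -leqNgt.
  by apply: leq_trans ca (ent_ge I a).
have [cn|nc] := leqP c (a + (n - k)).
  have hb : (c.-1 - a < n - k)%N by lia.
  apply: le_trans (nr (Some (a, Ordinal hb))); rewrite -momentB /diff /moment big_mkcond.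
  rewrite le_eqVlt; apply/orP; left; apply/eqP; congr `|_|.
  apply: eq_bigr => I _; rewrite /hom chibE /= (_ : (ent I a <= a + (c.-1 - a))%N = (ent I a < c)%N).
    by case: ifP; rewrite ?mulr1 ?mulr0.
  by lia.
apply: le_trans (nr None); rewrite -momentB moment_total /diff.
rewrite (eq_bigl xpredT) // => I; apply/idP; have := ent_le I a; lia.
Qed.

(** Positions from [b] on are filled with [ord0], so prefixes of all lengths live in one finite
    type. *)
Definition prefix (b : nat) I : {ffun 'I_k -> 'I_n.+1} :=
  [ffun a : 'I_k => if (a < b)%N then inord (ent I a) else ord0].

Lemma prefixP b I J : reflect (forall a : 'I_k, (a < b)%N -> ent I a = ent J a)
  (prefix b I == prefix b J).
Proof.
have le (K : V) (a : 'I_k) : (ent K a < n.+1)%N by apply: leq_trans (ent_ltn K a) (leqnSn n).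
apply: (iffP eqP) => [h a ab|h].
  move/ffunP/(_ a): h; rewrite !ffunE ab => /(congr1 val) /=.
  by rewrite !inordK.
by apply/ffunP => a; rewrite !ffunE; case: ifP => // /h ->.
Qed.

Let cell b pi (I : V) := prefix b I == pi.

Lemma diff_split lam mu (Q : pred V) (a : 'I_k) c : diff lam mu Q =
  diff lam mu (fun I => Q I && (ent I a < c)%N) +
  diff lam mu (fun I => Q I && (ent I a == c)) +
  diff lam mu (fun I => Q I && (c < ent I a)%N).
Proof.
rewrite /diff big_mkcond [X in _ = X + _ + _]big_mkcond [X in _ = _ + X + _]big_mkcond.
rewrite [X in _ = _ + X]big_mkcond -!big_split; apply: eq_bigr => I _ /=.
by case: (Q I); case: ltngtP => //= _; rewrite ?addr0 ?add0r.
Qed.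

(* Compare masses at the smallest value [c] of the entry [b] where they could differ:
   a surplus of [lam] on the prefix [pi] is compensated by a deficit on another prefix, and
   both are made up for at larger values, which contradicts [comp_exchange]. *)
Lemma diff_cell_value (b : 'I_k) c lam mu eta (K : F) pi : near lam mu eta -> 0 <= K ->
  2 * eta <= K ->
  (forall pi, `|diff lam mu (cell b pi)| <= K) ->
  (forall pi, `|diff lam mu (fun I => cell b pi I && (ent I b < c)%N)| <= K) ->
  diff lam mu (fun I => cell b pi I && (ent I b == c)) <=
    (3 + 2 * #|{ffun 'I_k -> 'I_n.+1}|%:R) * K.
Proof.
move=> nr K0 eK hcell hlt; rewrite leNgt; apply/negP => big.
set N : F := #|_|%:R in big; have N0 : 0 <= N by apply: ler0n.
pose d pi := diff lam mu (fun I => cell b pi I && (ent I b == c)).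
have hcol : diff lam mu (fun I => ent I b == c) <= K.
  have := diff_split lam mu (fun I => (ent I b < c.+1)%N) b c.
  have -> : diff lam mu (fun I => (ent I b < c.+1)%N && (ent I b < c)%N) =
            diff lam mu (fun I => (ent I b < c)%N).
    by apply: eq_bigl => I; lia.
  have -> : diff lam mu (fun I => (ent I b < c.+1)%N && (ent I b == c)%N) =
            diff lam mu (fun I => ent I b == c).
    by apply: eq_bigl => I; lia.
  have -> : diff lam mu (fun I => (ent I b < c.+1)%N && (c < ent I b)%N) = 0.
    by apply: big_pred0 => I; lia.
  have := diff_column b c nr; have := diff_column b c.+1 nr.
  by rewrite !ler_norml => /andP[_ h1] /andP[h2 _]; lra.
(* If every prefix had difference at least [- 2 * K], the large surplus on [pi] would push the sum
   over all prefixes above the column bound [hcol]. *)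
have [pi1 hpi1] : exists pi1, d pi1 < - (2 * K).
  apply/existsP; apply: contraT; rewrite negb_exists => /forallP h.
  have : \sum_pi0 (d pi0 + 2 * K) >= d pi + 2 * K.
    rewrite (bigD1 pi) //= lerDl; apply: sumr_ge0 => pi0 _.
    by have := h pi0; rewrite -leNgt; lra.
  rewrite big_split /= sumr_const -mulr_natr -/N.
  have -> : \sum_pi0 d pi0 = diff lam mu (fun I => ent I b == c).
    rewrite /diff (partition_big (prefix b) xpredT) //=; apply: eq_bigr => pi0 _.
    by apply: eq_bigl => I; rewrite andbC.
  by have : 0 <= N * K := mulr_ge0 N0 K0; move: big; rewrite -/(d pi); lra.
have pos (Q : pred V) : 0 < diff lam mu Q -> exists2 I, Q I & 0 < lam I.
  case: nr => _ mu0 _ _ _ /sum_gt0_ex[I QI h]; exists I => //.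
  by have := mu0 I; lra.
have neg (Q : pred V) : diff lam mu Q < 0 -> exists2 I, Q I & 0 < mu I.
  case: nr => lam0 _ _ _ _; rewrite diff_sym oppr_lt0 => /sum_gt0_ex[I QI h].
  by exists I => //; have := lam0 I; lra.
have NK : 0 <= N * K := mulr_ge0 N0 K0.
have split_d pi' : diff lam mu (cell b pi') =
    diff lam mu (fun I => cell b pi' I && (ent I b < c)%N) + d pi' +
    diff lam mu (fun I => cell b pi' I && (c < ent I b)%N) := diff_split _ _ _ _ _.
rewrite -/(d pi) in big.
have [I /andP[Ipi /eqP Ib] lamI] : exists2 I, cell b pi I && (ent I b == c) & 0 < lam I.
  by apply: (pos _ (_ : 0 < d pi)); move: big; lra.
have [J /andP[Jpi /eqP Jb] muJ] : exists2 I, cell b pi1 I && (ent I b == c) & 0 < mu I.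
  by apply: (neg _ (_ : d pi1 < 0)); move: hpi1; lra.
(* The whole cell of [pi1] and its part below [c] each account for at most [K], so a deficit beyond
   [2 * K] at [c] leaves a surplus above [c]. The case of [L] is symmetric. *)
have [K' /andP[Kpi Kb] lamK] : exists2 I, cell b pi1 I && (c < ent I b)%N & 0 < lam I.
  apply: pos; have := split_d pi1; move: hpi1.
  have := hcell pi1; have := hlt pi1; rewrite !ler_norml => /andP[? ?] /andP[? ?]; lra.
have [L /andP[Lpi Lb] muL] : exists2 I, cell b pi I && (c < ent I b)%N & 0 < mu I.
  apply: neg; have := split_d pi; move: big.
  have := hcell pi; have := hlt pi; rewrite !ler_norml => /andP[? ?] /andP[? ?]; lra.
case: nr => _ _ clam cmu _.
apply: (@comp_exchange b I J K' L); rewrite ?Ib ?Jb //; last 2 first.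
- exact: clam.
- exact: cmu.
- by apply/prefixP; rewrite (eqP Ipi) eq_sym.
- by apply/prefixP; rewrite (eqP Jpi) eq_sym.
move=> /prefixP; rewrite (eqP Ipi) (eqP Jpi) => /eqP e.
by move: hpi1; rewrite -e; move: big; lra.
Qed.

(** Induction on the length of the prefix and, within it, on the bound for the next entry. The
    constant is chosen before [lam] and [mu], so it is uniform in them. *)
Lemma diff_prefix_bound b : (b <= k)%N -> exists2 C : F, 0 <= C &
  forall lam mu eta, near lam mu eta -> forall pi, `|diff lam mu (cell b pi)| <= C * eta.
Proof.
elim: b => [_|b IH bk].
  exists 1 => // lam mu eta nr pi; rewrite mul1r.
  have eta0 := near_ge0 nr; case: nr => _ _ _ _ nr.
  have e I : cell 0 pi I = (pi == [ffun=> ord0]).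
    by rewrite /cell eq_sym; congr (_ == _); apply/ffunP => a; rewrite !ffunE.
  rewrite /diff (eq_bigl _ _ e); case: (pi == _); last by rewrite big_pred0 ?normr0.
  by rewrite -moment_total momentB.
have [C0 C00 hC0] := IH (ltnW bk); pose bo := Ordinal bk.
have /(_ n) [C1 C10 hC1] : forall m, exists2 C, 0 <= C &
    forall lam mu eta, near lam mu eta -> forall pi c, (c <= m)%N ->
      `|diff lam mu (fun I => cell b pi I && (ent I bo < c)%N)| <= C * eta.
  elim=> [|c [C C_ge0 hC]].
    exists 0 => // lam mu eta nr pi c; rewrite leqn0 => /eqP->.
    by rewrite /diff big_pred0 ?mul0r ?normr0 // => I; rewrite andbF.
  (* Chosen so that [C' * eta] dominates both inductive bounds and [2 * eta], as [diff_cell_value]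
     requires. *)
  pose C' := C0 + C + 2; pose N : F := #|{ffun 'I_k -> 'I_n.+1}|%:R.
  have N0 : 0 <= N by apply: ler0n.
  exists (C + (3 + 2 * N) * C'); first by rewrite /C'; nra.
  move=> lam mu eta nr pi c'; have eta0 := near_ge0 nr.
  have [c'c _|cc' c'c] := leqP c' c.
    apply: le_trans (hC _ _ _ nr pi _ c'c) _; apply: ler_wpM2r => //.
    by rewrite lerDl /C'; nra.
  have -> : c' = c.+1 by lia.
  have key l m : near l m eta ->
      diff l m (fun I => cell b pi I && (ent I bo == c)) <= (3 + 2 * N) * (C' * eta).
    move=> nr'; apply: (@diff_cell_value bo c l m eta) => //.
    - by rewrite /C'; nra.
    - by rewrite /C'; nra.
    - by move=> pi'; apply: le_trans (hC0 _ _ _ nr' pi') _; rewrite /C'; nra.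
    - by move=> pi'; apply: le_trans (hC _ _ _ nr' pi' c _) _ => //; rewrite /C'; nra.
  have h1 := key _ _ nr; have h2 := key _ _ (near_sym nr).
  have := hC _ _ _ nr pi c (leqnn _).
  have := diff_split lam mu (fun I => cell b pi I && (ent I bo < c.+1)%N) bo c.
  have -> : diff lam mu (fun I => cell b pi I && (ent I bo < c.+1)%N && (ent I bo < c)%N) =
     diff lam mu (fun I => cell b pi I && (ent I bo < c)%N).
    by apply: eq_bigl => I; case: cell => //=; lia.
  have -> : diff lam mu (fun I => cell b pi I && (ent I bo < c.+1)%N && (ent I bo == c)%N) =
     diff lam mu (fun I => cell b pi I && (ent I bo == c)).
    by apply: eq_bigl => I; case: cell => //=; lia.
  have -> : diff lam mu (fun I => cell b pi I && (ent I bo < c.+1)%N && (c < ent I bo)%N) = 0.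
    by apply: big_pred0 => I; case: cell => //=; lia.
  move=> ->; rewrite diff_sym in h2; rewrite !ler_norml => /andP[h3 h4]; lra.
(* A cell of length [b.+1] is empty or a difference of two cumulative cells over its prefix of
   length [b], whence the factor 2. *)
exists (2 * C1); first lra.
move=> lam mu eta nr pi; have eta0 := near_ge0 nr.
case: (pickP (cell b.+1 pi)) => [J /eqP Jpi|none]; last first.
  by rewrite /diff big_pred0 // normr0; nra.
have e (I : V) : cell b.+1 pi I = cell b (prefix b J) I && (ent I bo == ent J bo).
  rewrite /cell -Jpi; apply/prefixP/andP => [h|[/prefixP h /eqP hb] a].
    split; last by rewrite h.
    by apply/prefixP => a ab; apply: h; apply: leqW.
  rewrite ltnS leq_eqVlt => /orP[/eqP ab|/h//].
  by rewrite (_ : a = bo) //; apply: val_inj.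
set c := ent J bo in e.
have cn : (c < n)%N by apply: ent_ltn.
have := hC1 _ _ _ nr (prefix b J) _ (ltnW cn); have := hC1 _ _ _ nr (prefix b J) _ cn.
rewrite (diff_split _ _ (fun I => _ && (_ < c.+1)%N) bo c).
have -> : diff lam mu (fun I => cell b (prefix b J) I && (ent I bo < c.+1)%N && (ent I bo < c)%N) =
    diff lam mu (fun I => cell b (prefix b J) I && (ent I bo < c)%N).
  by apply: eq_bigl => I; case: cell => //=; lia.
have -> : diff lam mu (fun I => cell b (prefix b J) I && (ent I bo < c.+1)%N && (ent I bo == c)%N) =
    diff lam mu (cell b.+1 pi).
  by apply: eq_bigl => I; rewrite e; case: cell => //=; lia.
have -> : diff lam mu (fun I => cell b (prefix b J) I && (ent I bo < c.+1)%N && (c < ent I bo)%N) = 0.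
  by apply: big_pred0 => I; case: cell => //=; lia.
by rewrite !ler_norml => /andP[h1 h2] /andP[h3 h4]; apply/andP; split; lra.
Qed.

(** A prefix of length [k] is the whole vector, so its cell is a singleton. *)
Lemma carried_lipschitz : exists2 C : F, 0 <= C & forall lam mu eta, near lam mu eta ->
  forall I, `|lam I - mu I| <= C * eta.
Proof.
have [C C0 hC] := diff_prefix_bound (leqnn k); exists C => // lam mu eta nr I.
have := hC _ _ _ nr (prefix k I); rewrite /diff (big_pred1 I) // => J.
apply/prefixP/eqP => [h|-> //]; apply: ent_inj => a; exact: h.
Qed.

Lemma carried_unique lam mu : (forall I, 0 <= lam I) -> (forall I, 0 <= mu I) ->
  carried comp lam -> carried comp mu -> moment lam =1 moment mu -> lam =1 mu.
Proof.
move=> h1 h2 h3 h4 h5 I; have [C _ hC] := carried_lipschitz.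
have nr : near lam mu 0 by split=> // q; rewrite h5 subrr normr0.
by have := hC _ _ _ nr I; rewrite mulr0 normr_le0 subr_eq0 => /eqP.
Qed.

End Comparison.
End Moments.

(** * f-vectors and multisets *)

Section MultisetCount.
Variable T : finType.
Implicit Types (s t : {set T}) (D : complex T).

Definition mset_supp N (m : {ffun T -> 'I_N.+1}) : {set T} := [set v | (0 < m v)%N].

(** Capping multiplicities at [N] loses nothing when the total is [N], and makes the multisets a
    finite type. *)
Definition msets N D : {set {ffun T -> 'I_N.+1}} :=
  [set m : {ffun T -> 'I_N.+1} | (\sum_v m v == N)%N && D (mset_supp m)].

Let exact N s := msets N (pred1 s).

Lemma card_msets N D : #|msets N D| = (\sum_(s | D s) #|exact N s|)%N.
Proof.
rewrite -sum1_card (partition_big (@mset_supp N) D) /=.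
  apply: eq_bigr => s Ds; rewrite -sum1_card; apply: eq_bigl => m.
  by rewrite !inE -andbA /=; case: eqP => //= _; case: eqP => [->|]; rewrite ?Ds ?andbF.
by move=> m; rewrite inE => /andP[].
Qed.

(** Multiplicities are transported along the bijection that matches elements of [s] and [t] with the
    same index in their enumerations. *)
Lemma card_exact_le N s t : #|s| = #|t| -> (#|exact N s| <= #|exact N t|)%N.
Proof.
move=> st; case: (pickP (fun _ : T => true)) => [x0 _|none]; last first.
  by rewrite (_ : s = t) //; apply/setP => x; have := none x.
pose move_to s' t' (v : T) := nth x0 (enum s') (index v (enum t')).
have movK s' t' v : #|s'| = #|t'| -> v \in s' -> move_to s' t' (move_to t' s' v) = v.
  move=> e vs; rewrite /move_to index_uniq ?enum_uniq ?nth_index ?mem_enum //.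
  by rewrite -cardE -e cardE index_mem mem_enum.
have mov_in s' t' v : #|s'| = #|t'| -> v \in t' -> move_to s' t' v \in s'.
  move=> e vt; rewrite -mem_enum /move_to mem_nth //.
  by rewrite -cardE e cardE index_mem mem_enum.
pose f (m : {ffun T -> 'I_N.+1}) : {ffun T -> 'I_N.+1} :=
  [ffun v => if v \in t then m (move_to s t v) else ord0].
have supp_out m v s' : m \in exact N s' -> v \notin s' -> m v = ord0.
  rewrite !inE => /andP[_ /eqP ms] vs; apply/val_inj/eqP; move: vs.
  by rewrite -ms inE -leqNgt leqn0.
have finj : {in exact N s &, injective f}.
  move=> m1 m2 h1 h2 /ffunP e; apply/ffunP => v.
  have [vs|vs] := boolP (v \in s); last by rewrite (supp_out _ _ _ h1 vs) (supp_out _ _ _ h2 vs).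
  by have := e (move_to t s v); rewrite !ffunE mov_in ?movK.
rewrite -(card_in_imset finj); apply/subset_leq_card/subsetP => _ /imsetP[m hm ->].
have := hm; rewrite !inE => /andP[/eqP sm /eqP ms]; apply/andP; split.
  apply/eqP; rewrite -[RHS]sm (bigID (mem t)) /= [X in (_ + X)%N]big1 ?addn0; last first.
    by move=> v /negPf vt; rewrite ffunE vt.
  rewrite [RHS](bigID (mem s)) /= [X in _ = (_ + X)%N]big1 ?addn0; last first.
    by move=> v vs; rewrite (supp_out _ _ _ hm vs).
  rewrite -!big_enum !(big_nth x0) -!cardE st; apply: congr_big_nat => // i /= it.
  have ti : nth x0 (enum t) i \in t by rewrite -mem_enum mem_nth // -cardE.
  by rewrite ffunE ti /move_to index_uniq ?enum_uniq // -cardE.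
apply/eqP/setP => v; rewrite inE ffunE; have [vt|//] := boolP (v \in t).
by have := mov_in _ _ _ st vt; rewrite -{2}ms inE.
Qed.

Lemma card_exact N s t : #|s| = #|t| -> #|exact N s| = #|exact N t|.
Proof. by move=> e; apply/eqP; rewrite eqn_leq !card_exact_le. Qed.

(** This makes the system for the f-vector triangular; the next lemma makes its diagonal nonzero,
    through the indicator of [s]. *)
Lemma card_exact_gt N s : (N < #|s|)%N -> #|exact N s| = 0%N.
Proof.
move=> h; apply: eq_card0 => m; rewrite !inE; apply/negP => /andP[/eqP sm /eqP ms].
move: h; rewrite -sm ltnNge => /negP; apply.
rewrite -sum1_card big_mkcond; apply: leq_sum => v _.
by rewrite -ms inE; case: ifP.
Qed.

Lemma card_exact_gt0 s : (0 < #|exact #|s| s|)%N.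
Proof.
apply/card_gt0P; exists [ffun v => inord (v \in s)].
have e v : ([ffun v => inord (v \in s)] : {ffun T -> 'I_(#|s|).+1}) v = (v \in s) :> nat.
  rewrite ffunE inordK //; case: (boolP (v \in s)) => // vs; rewrite ltnS.
  by apply/card_gt0P; exists v.
rewrite !inE; apply/andP; split.
  by rewrite (eq_bigr _ (fun v _ => e v)) -sum1_card [X in _ == X]big_mkcond.
by apply/eqP/setP => v; rewrite inE e lt0b.
Qed.

(* Grouping multisets of size [N] by the cardinality [i] of their support gives a triangular
   linear system for the [f]-vector. *)
Lemma fvec_of_msets D1 D2 :
  (forall N, #|msets N D1| = #|msets N D2|) -> forall i, fvec D1 i = fvec D2 i.
Proof.
(* A representative of cardinality [i]; the default [set0] is taken only when no such set exists,
   and then [fvec D i] vanishes. *)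
move=> h; pose rep i : {set T} := odflt set0 [pick s : {set T} | #|s| == i].
have expand D N : #|msets N D| = (\sum_(i < #|T|.+1) fvec D i * #|exact N (rep i)|)%N.
  rewrite card_msets (partition_big (fun s : {set T} => inord #|s| : 'I_(#|T|.+1)) xpredT) //=.
  apply: eq_bigr => i _; rewrite /fvec -sum_nat_const; apply: congr_big => // s.
    rewrite inE; case: (D s) => //=; rewrite -val_eqE /= inordK //.
    by rewrite ltnS max_card.
  move=> /andP[_ /eqP si]; apply: card_exact; rewrite /rep.
  have es : #|s| = i by rewrite -si inordK // ltnS max_card.
  by case: pickP => [t /eqP -> //|/(_ s)]; rewrite es eqxx.
have hrep i : #|rep i| = i \/ forall D, fvec D i = 0%N.
  rewrite /rep; case: pickP => [s /eqP|none]; [by left|right => D].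
  by apply: eq_card0 => s; rewrite inE none andbF.
have big D i : (#|T| < i)%N -> fvec D i = 0%N.
  move=> Ti; apply: eq_card0 => s; rewrite inE; apply/negbTE/negP => /andP[_ /eqP e].
  by have := max_card (mem s); rewrite e leqNgt Ti.
elim/ltn_ind => N IH; have [TN|NT] := ltnP #|T| N; first by rewrite !big.
have := h N; rewrite !expand; have NT' : (N < #|T|.+1)%N by [].
case: (hrep N) => [sN|z]; last by rewrite !z.
rewrite (bigD1 (Ordinal NT')) //= [in RHS](bigD1 (Ordinal NT')) //=.
rewrite (eq_bigr (fun i : 'I_(#|T|.+1) => fvec D2 i * #|exact N (rep i)|)%N).
  move/addIn/eqP; rewrite eqn_pmul2r; first by move/eqP.
  by move: (card_exact_gt0 (rep N)); rewrite sN.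
move=> i iN; have [lt|ge] := ltnP i N; first by rewrite IH.
case: (hrep i) => [si|z]; last by rewrite !z.
have lt : (N < i)%N by rewrite ltn_neqAle ge andbT eq_sym -val_eqE in iN *.
by rewrite card_exact_gt ?muln0 ?si.
Qed.
End MultisetCount.

(** * Swaps on combinations and multisets, and equality of the f-vectors *)

Section Swapping.
Variables (F : realFieldType) (k n : nat).
Local Notation V := (Vkn k n).
Local Notation P := (Pkn k n).
Implicit Types (I J : V) (lam mu : V -> F).
Variables (comp : rel V) (w : V -> int).
Hypothesis comp_refl : reflexive comp.
Hypothesis comp_swap : swappable comp w.
Local Open Scope ring_scope.

Definition weight lam : F := \sum_I lam I * (w I)%:~R.

Definition shift lam (t : F) I J I' J' : V -> F := fun K =>
  lam K + t * ((K == I')%:R + (K == J')%:R - (K == I)%:R - (K == J)%:R).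

Lemma sum_shift (x : V -> F) lam t I J I' J' :
  \sum_K shift lam t I J I' J' K * x K =
  \sum_K lam K * x K + t * (x I' + x J' - x I - x J).
Proof.
have delta I0 : \sum_K (K == I0)%:R * x K = x I0.
  by rewrite (bigD1 I0) //= eqxx mul1r big1 ?addr0 // => K /negPf->; rewrite mul0r.
under eq_bigr do rewrite /shift mulrDl -mulrA !mulrBl mulrDl.
by rewrite big_split -mulr_sumr /= !sumrB big_split /= !delta.
Qed.

(** Reflexivity of [comp] makes the incompatible vertices distinct, so mass can be taken from both
    at once. *)
Lemma swap_pair lam : ~ carried comp lam -> exists I J I' J',
  [/\ I != J, 0 < lam I, 0 < lam J,
      forall t, moment (shift lam t I J I' J') =1 moment lam &
      forall t, 0 < t -> weight (shift lam t I J I' J') < weight lam].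
Proof.
move=> nc; have [I [J [hI hJ nIJ]]] : exists I, exists J, [/\ 0 < lam I, 0 < lam J & ~~ comp I J].
  apply: contrapT => h; apply: nc => I J hI hJ; apply: contrapT => /negP c.
  by apply: h; exists I, J.
have [I' [J' [hp hw]]] := comp_swap nIJ; exists I, J, I', J'; split=> //.
- by apply: contraNneq nIJ => ->.
- move=> t q; rewrite /moment sum_shift -[RHS]addr0; congr (_ + _); apply/eqP.
  rewrite mulf_eq0; apply/orP; right; apply/eqP; case: q => [p|] /=; last ring.
  by have := congr1 (fun m => m%:R : F) (hp p); rewrite !natrD => h; lra.
- move=> t t0; rewrite /weight sum_shift gtrDl pmulr_rlt0 //.
  have : ((w I' + w J')%:~R : F) < (w I + w J)%:~R by rewrite ltr_int.
  rewrite !intrD; lra.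
Qed.

Definition mset_fun N (m : {ffun V -> 'I_N.+1}) : V -> F := fun I => (val (m I))%:R.

Lemma mset_fun_total N (m : {ffun V -> 'I_N.+1}) :
  moment (mset_fun m) None = (\sum_I m I)%:R.
Proof. by rewrite moment_total natr_sum. Qed.

(** Among the finitely many multisets with the given moments, take one of least weight: a unit swap
    would give another such multiset of smaller weight. *)
Lemma carried_mset N (m : {ffun V -> 'I_N.+1}) : (\sum_I m I = N)%N ->
  exists m' : {ffun V -> 'I_N.+1}, [/\ (\sum_I m' I = N)%N,
    moment (mset_fun m') =1 moment (mset_fun m) & carried comp (mset_fun m')].
Proof.
move=> mN; pose good (m' : {ffun V -> 'I_N.+1}) :=
  [forall q, moment (mset_fun m') q == moment (mset_fun m) q].
have gm : good m by apply/forallP.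
have total m' : good m' -> (\sum_I m' I = N)%N.
  move=> /forallP/(_ None)/eqP; rewrite !mset_fun_total mN => /eqP.
  by rewrite eqr_nat => /eqP.
case: (arg_minP (fun m' => weight (mset_fun m')) gm) => m' gm' mmin.
exists m'; split; [exact: total|by move=> q; exact: (eqP (forallP gm' q))|].
apply: contrapT => /swap_pair [I [J [I' [J' [IJ hI hJ hm hw]]]]].
(* Truncated subtraction is exact here, since [I] and [J] are distinct and both have positive
   multiplicity. *)
have cast (K : V) : (val (m' K))%:R - (K == I)%:R - (K == J)%:R =
    (val (m' K) - (K == I) - (K == J))%:R :> F.
  move: hI hJ; rewrite /mset_fun !ltr0n => hI hJ.
  have h : ((K == I) + (K == J) <= val (m' K))%N.
    case: eqVneq => [->|_]; first by rewrite (negPf IJ) addn0.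
    by case: eqVneq => [->|_].
  by rewrite -subnDA natrB // natrD opprD addrA.
pose g (K : V) : nat := (val (m' K) - (K == I) - (K == J) + (K == I') + (K == J'))%N.
have eg (K : V) : (g K)%:R = shift (mset_fun m') 1 I J I' J' K.
  by rewrite /g !natrD -cast /shift /mset_fun; ring.
have gN : (\sum_K g K = N)%N.
  apply/eqP; rewrite -(eqr_nat F) natr_sum (eq_bigr _ (fun K _ => eg K)).
  by rewrite -moment_total hm mset_fun_total total.
have gle (K : V) : (g K <= N)%N by rewrite -[leqRHS]gN (bigD1 K) //= leq_addr.
pose m2 : {ffun V -> 'I_N.+1} := [ffun K => inord (g K)].
have em2 : mset_fun m2 =1 shift (mset_fun m') 1 I J I' J'.
  by move=> K; rewrite -eg /mset_fun ffunE /= inordK // ltnS.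
have g2 : good m2.
  by apply/forallP => q; rewrite (eq_moment em2) hm; apply: (forallP gm').
have := mmin _ g2; rewrite leNgt => /negP; apply.
by rewrite /weight (eq_bigr _ (fun K _ => congr1 (fun x => x * _) (em2 K))); apply: hw.
Qed.
End Swapping.

Section CliqueFvec.
Variables k n : nat.
Local Notation V := (Vkn k n).

(** [NC k n] and [NN k n] unfold to this for their respective relations, which allows a common
    treatment. *)
Definition clique (comp : rel V) : complex V :=
  fun s => [forall I in s, forall J in s, comp I J].

Lemma cliqueP (comp : rel V) (s : {set V}) :
  reflect {in s &, forall I J, comp I J} (clique comp s).
Proof.
apply: (iffP forall_inP) => [h I J Is Js|h I Is]; first by have /forall_inP := h I Is; apply.
by apply/forall_inP => J Js; apply: h.
Qed.

Lemma clique_mset (F : realFieldType) (comp : rel V) N (m : {ffun V -> 'I_N.+1}) :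
  clique comp (mset_supp m) <-> carried comp (mset_fun F m).
Proof.
split=> [/cliqueP h I J|h]; first by rewrite !ltr0n => hI hJ; apply: h; rewrite inE.
by apply/cliqueP => I J; rewrite !inE => hI hJ; apply: h; rewrite ltr0n.
Qed.

(** Replacing a multiset by a [comp']-carried one keeps its moments, and moments determine a
    [comp]-carried multiset; so the replacement is injective. *)
Lemma card_msets_le (comp comp' : rel V) (w : V -> int) N :
  exchange_free comp -> reflexive comp' -> swappable comp' w ->
  (#|msets N (clique comp)| <= #|msets N (clique comp')|)%N.
Proof.
move=> hX hr hS.
have /choice [f hf] : forall m : {ffun V -> 'I_N.+1}, exists m' : {ffun V -> 'I_N.+1},
   (\sum_I m I = N)%N -> [/\ (\sum_I m' I = N)%N,
    moment (mset_fun rat m') =1 moment (mset_fun rat m) & carried comp' (mset_fun rat m')].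
  move=> m; case: (eqVneq (\sum_I m I)%N N) => [e|ne]; last first.
    by exists m => e; case/eqP: ne.
  by have [m' h] := carried_mset rat hr hS e; exists m'.
have finj : {in msets N (clique comp) &, injective f}.
  move=> m1 m2; rewrite !inE => /andP[/eqP e1 /clique_mset c1] /andP[/eqP e2 /clique_mset c2] e.
  have [_ h1 _] := hf _ e1; have [_ h2 _] := hf _ e2.
  have h : mset_fun rat m1 =1 mset_fun rat m2.
    have ge0 (m : {ffun V -> 'I_N.+1}) I : (0 <= mset_fun rat m I)%R by apply: ler0n.
    by apply: (carried_unique hX) => // q; rewrite -h1 -h2 e.
  apply/ffunP => I; apply/val_inj/eqP; have := h I => /eqP.
  by rewrite eqr_nat.
rewrite -(card_in_imset finj); apply/subset_leq_card/subsetP => _ /imsetP[m hm ->].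
move: hm; rewrite !inE => /andP[/eqP /hf [-> _ c] _]; rewrite eqxx /=.
exact/clique_mset/c.
Qed.

Lemma fvec_NC_NN i : fvec (NC k n) i = fvec (NN k n) i.
Proof.
apply: fvec_of_msets => N; apply/eqP; rewrite eqn_leq; apply/andP; split.
  apply: card_msets_le (@nonnesting_swappable k n).
    exact: noncrossing_exchange_free.
  exact: nonnesting_refl.
apply: card_msets_le (@noncrossing_swappable k n).
  exact: nonnesting_exchange_free.
exact: noncrossing_refl.
Qed.

(** The dimension is the largest index at which the f-vector is nonzero, so the h-vector depends on
    the f-vector alone. *)
Lemma hvec_NC_NN j : hvec (NC k n) j = hvec (NN k n) j.
Proof.
have cdimE (D : complex V) : cdim D = \max_(i < #|V|.+1 | (0 < fvec D i)%N) i.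
  apply/eqP; rewrite eqn_leq; apply/andP; split; apply/bigmax_leqP.
    move=> s Ds; have h : (#|s| < #|V|.+1)%N by rewrite ltnS max_card.
    apply: (@leq_bigmax_cond _ _ (fun i : 'I_#|V|.+1 => val i) (Ordinal h)) => /=.
    by apply/card_gt0P; exists s; rewrite inE Ds /=.
  move=> i /card_gt0P[s]; rewrite inE => /andP[Ds /eqP <-].
  exact: (@leq_bigmax_cond _ _ (fun s : {set V} => #|s|)).
have e : cdim (NC k n) = cdim (NN k n).
  by rewrite !cdimE; apply: eq_bigl => i; rewrite fvec_NC_NN.
by apply: eq_bigr => i _; rewrite e fvec_NC_NN.
Qed.
End CliqueFvec.

(** * Representations of minimal weight *)

(** Extends the inequalities of the order polytope, which are imposed on neighbours only, to all
    comparable indices. *)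
Lemma ord_step_ind m (R : 'I_m -> 'I_m -> Prop) : (forall i, R i i) ->
  (forall i j l, R i j -> R j l -> R i l) ->
  (forall i j : 'I_m, val j = (val i).+1 -> R i j) ->
  forall i j : 'I_m, (i <= j)%N -> R i j.
Proof.
move=> Rr Rt Rs i [j hj]; elim: j hj => [|j IH] hj /=.
  by rewrite leqn0 => /eqP i0; rewrite (_ : i = Ordinal hj) //; apply: val_inj.
rewrite leq_eqVlt => /orP[/eqP ij|ij].
  by rewrite (_ : i = Ordinal hj) //; apply: val_inj.
exact: Rt (IH (ltnW hj) ij) (Rs _ _ _).
Qed.

Section LayerCake.
Variables (F : realFieldType) (k n : nat).
Hypothesis kn : (k <= n)%N.
Local Notation V := (Vkn k n).
Local Notation P := (Pkn k n).
Local Open Scope ring_scope.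

(** Entry [a] is [a] plus the first column at which row [a] enters [S]. *)
Lemma vertex_of_filter (S : pred P) :
  (forall (a : 'I_k) (b b' : 'I_(n - k)), val b' = (val b).+1 -> S (a, b) -> S (a, b')) ->
  (forall (a a' : 'I_k) (b : 'I_(n - k)), val a' = (val a).+1 -> S (a', b) -> S (a, b)) ->
  exists I : V, chib I =1 S.
Proof.
move=> hb ha.
have {}hb (a : 'I_k) (b b' : 'I_(n - k)) : (b <= b')%N -> S (a, b) -> S (a, b').
  move: b b'; apply: (@ord_step_ind (n - k) (fun b b' => S (a, b) -> S (a, b'))) => //.
    by move=> i j l h1 h2 /h1/h2.
  by move=> i j; apply: hb.
have {}ha (a a' : 'I_k) (b : 'I_(n - k)) : (a <= a')%N -> S (a', b) -> S (a, b).
  move: a a'; apply: (@ord_step_ind k (fun a a' => S (a', b) -> S (a, b))) => //.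
    by move=> i j l h1 h2 /h2/h1.
  by move=> i j; apply: ha.
(* True vacuously at [b = n - k], so the minimum [m a] exists even when row [a] misses [S]. *)
pose S' a (b : nat) := [forall b' : 'I_(n - k), (b' == b :> nat) ==> S (a, b')].
have exS a : exists b, S' a b.
  exists (n - k)%N; apply/forallP => b'; apply/implyP => /eqP e.
  by have := ltn_ord b'; rewrite e ltnn.
pose m a := ex_minn (exS a).
have mP a b : (m a <= b)%N = S' a b.
  rewrite /m; case: ex_minnP => c Sc cmin; apply/idP/idP; last exact: cmin.
  move=> cb; apply/forallP => b'; apply/implyP => /eqP e; subst b.
  have cn : (c < n - k)%N by apply: leq_ltn_trans (ltn_ord b').
  have /implyP/(_ (eqxx _)) := forallP Sc (Ordinal cn).
  exact: hb.
have mn a : (m a <= n - k)%N.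
  rewrite mP; apply/forallP => b'; apply/implyP => /eqP e.
  by have := ltn_ord b'; rewrite e ltnn.
have mm (a a' : 'I_k) : (a <= a')%N -> (m a <= m a')%N.
  move=> aa; rewrite mP; have := leqnn (m a'); rewrite [in X in X -> _]mP => /forallP h.
  by apply/forallP => b; apply/implyP => /(implyP (h b)); apply: ha.
have [a|a a' aa|I hI] := @vector_of k n (fun a => (a + m a)%N).
- by have := mn a; have := ltn_ord a; lia.
- by have := mm a a' (ltnW aa); lia.
exists I => -[a b]; rewrite chibE hI leq_add2l mP; apply/forallP/idP => [/(_ b)|h b'].
  by rewrite eqxx.
by apply/implyP => /eqP/val_inj ->.
Qed.

Definition monotone (y : P -> F) :=
  (forall (a : 'I_k) (b b' : 'I_(n - k)), val b' = (val b).+1 -> y (a, b) <= y (a, b')) /\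
  (forall (a a' : 'I_k) (b : 'I_(n - k)), val a' = (val a).+1 -> y (a', b) <= y (a, b)).

(** The support of [y] is a filter, hence a vertex; subtracting the least positive value of [y]
    times this vertex kills a coordinate. At the end the remaining mass goes to the vertex with zero
    coordinates. *)
Lemma layer_cake (y : P -> F) (c : F) : monotone y -> (forall p, 0 <= y p <= c) -> 0 <= c ->
  exists lam : V -> F, [/\ forall I, 0 <= lam I, moment lam None = c &
    forall p, moment lam (Some p) = y p].
Proof.
have [N] := ubnP #|[set p | 0 < y p]|; elim: N y c => // N IH y c leN mono yc c0.
case: (pickP (fun p => 0 < y p)) => [p1 yp1|none]; last first.
  have [||I hI] := @vertex_of_filter pred0; [by []|by []|].
  exists (fun J => c * (J == I)%:R); split.
  - by move=> J; rewrite mulr_ge0 ?ler0n.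
  - by rewrite momentZ moment_delta mulr1.
  - move=> p; rewrite momentZ moment_delta /= hI mulr0.
    have := none p; have /andP[h _] := yc p; have [//|h' _] := ltP 0 (y p).
    by apply/eqP; rewrite eq_le h h'.
case: (@arg_minP _ _ _ p1 (fun p => 0 < y p) y yp1) => p0 yp0 pmin.
have [||I hI] := @vertex_of_filter (fun p => 0 < y p).
- by move=> a b b' e h; apply: lt_le_trans h (mono.1 _ _ _ e).
- by move=> a a' b e h; apply: lt_le_trans h (mono.2 _ _ _ e).
pose y' p := y p - y p0 * (chib I p)%:R.
have step p q : y p <= y q -> y' p <= y' q.
  rewrite /y' !hI => pq; have [hp|hp] := ltP 0 (y p).
    by rewrite (lt_le_trans hp pq) /=; lra.
  have [hq|hq] /= := ltP 0 (y q); last lra.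
  by have := pmin q hq; have /andP[] := yc p; lra.
have [||||lam' [l0 lN lS]] := IH y' (c - y p0).
- rewrite -ltnS; apply: leq_trans leN; apply: proper_card; apply/properP; split.
    apply/subsetP => p; rewrite !inE; apply: contraTT => /negbTE e.
    by rewrite /y' hI e mulr0 subr0 e.
  by exists p0; rewrite !inE // /y' hI yp0 mulr1 subrr ltxx.
- by split=> [a b b' e|a a' b e]; apply: step; [apply: mono.1|apply: mono.2].
- move=> p; rewrite /y' hI; have /andP[h1 h2] := yc p; have /andP[h3 h4] := yc p0.
  have [hp|hp] /= := ltP 0 (y p); last by rewrite mulr0; apply/andP; split; lra.
  by have := pmin p hp; rewrite mulr1 => h; apply/andP; split; lra.
- by rewrite subr_ge0; have /andP[] := yc p0.
exists (fun J => lam' J + y p0 * (J == I)%:R); split.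
- by move=> J; rewrite addr_ge0 // mulr_ge0 ?ler0n // ltW.
- by rewrite momentD momentZ moment_delta lN /=; ring.
- by move=> p; rewrite momentD momentZ moment_delta lS /y' /=; ring.
Qed.
End LayerCake.

Section Minimal.
Variables (F : realFieldType) (k n : nat).
Local Notation V := (Vkn k n).
Implicit Types (I J : V) (lam mu nu : V -> F).
Variables (comp : rel V) (w : V -> int).
Hypothesis comp_refl : reflexive comp.
Hypothesis comp_swap : swappable comp w.
Local Open Scope ring_scope.

Let supp nu := [set I | nu I != 0].

(** Linear independence of the homogenized vertices in the support of [nu]. *)
Definition independent nu := forall del : V -> F, (forall I, nu I = 0 -> del I = 0) ->
  (forall q, moment del q = 0) -> forall I, del I = 0.

Lemma weightD lam mu : weight w (fun I => lam I + mu I) = weight w lam + weight w mu.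
Proof. by rewrite /weight -big_split; apply: eq_bigr => I _; rewrite mulrDl. Qed.

Lemma weightZ c lam : weight w (fun I => c * lam I) = c * weight w lam.
Proof. by rewrite /weight mulr_sumr; apply: eq_bigr => I _; rewrite mulrA. Qed.

(** Move along a linear relation on the support, signed so that the weight does not grow, until some
    coefficient reaches zero. *)
Lemma caratheodory nu : (forall I, 0 <= nu I) -> exists mu,
  [/\ forall I, 0 <= mu I, moment mu =1 moment nu, weight w mu <= weight w nu & independent mu].
Proof.
have [N] := ubnP #|supp nu|; elim: N nu => // N IH nu leN nu0.
case: (EM (independent nu)) => [ind|nind]; first by exists nu.
have [del [dsupp dmom [I0 dI0] dw]] : exists del : V -> F,
    [/\ forall I, nu I = 0 -> del I = 0, forall q, moment del q = 0, exists I, del I != 0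
      & weight w del <= 0].
  have [del [dsupp dmom [I0 dI0]]] : exists del : V -> F,
      [/\ forall I, nu I = 0 -> del I = 0, forall q, moment del q = 0 & exists I, del I != 0].
    apply: contrapT => h; apply: nind => del h1 h2 I; apply/eqP/negP => /negP h3.
    by apply: h; exists del; split=> //; exists I.
  have [dw|dw] := leP (weight w del) 0; first by exists del; split=> //; exists I0.
  exists (fun I => -1 * del I); split.
  - by move=> I /dsupp ->; rewrite mulr0.
  - by move=> q; rewrite momentZ dmom mulr0.
  - by exists I0; rewrite mulN1r oppr_eq0.
  - by rewrite weightZ mulN1r oppr_le0 ltW.
(* A nonzero relation has total mass zero, so it takes a negative value. *)
have [I1 dI1] : exists I, del I < 0.
  apply: contrapT => h; have dge I : 0 <= del I.
    by rewrite leNgt; apply/negP => h'; apply: h; exists I.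
  have := dmom None; rewrite moment_total => /eqP; rewrite psumr_eq0 // => /allP/(_ I0).
  by rewrite mem_index_enum /= (negPf dI0) => /(_ isT).
case: (@arg_minP _ _ _ I1 (fun I => del I < 0) (fun I => nu I / - del I) dI1) => I2 dI2 I2min.
set t := nu I2 / - del I2 in I2min.
have t0 : 0 <= t by rewrite divr_ge0 // oppr_ge0 ltW.
pose nu' I := nu I + t * del I.
have nu'0 I : 0 <= nu' I.
  rewrite /nu'; have [h|h] := ltP (del I) 0; last by apply: addr_ge0; [exact: nu0|exact: mulr_ge0].
  have := I2min I h; rewrite ler_pdivlMr ?oppr_gt0 //; lra.
have nu'I2 : nu' I2 = 0 by rewrite /nu' /t; field; rewrite lt_eqF.
have [|mu [m1 m2 m3 m4]] := IH nu' _ nu'0.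
  rewrite -ltnS; apply: leq_trans leN; apply: proper_card; apply/properP; split.
    apply/subsetP => I; rewrite !inE /nu'; apply: contra => /eqP h.
    by rewrite h dsupp // mulr0 addr0.
  exists I2; rewrite inE ?nu'I2 ?eqxx //; apply: contraTneq dI2 => /dsupp->.
  by rewrite ltxx.
exists mu; split=> //.
- by move=> q; rewrite m2 momentD momentZ dmom mulr0 addr0.
- apply: le_trans m3 _; rewrite weightD weightZ gerDl; exact: mulr_ge0_le0.
Qed.

(** Only independent representations need comparing, and each is determined by its support;
    finiteness of the set of supports thus replaces compactness. The list [l] in [key] holds the
    supports already beaten. *)
Lemma minimal_exists nu : (forall I, 0 <= nu I) -> exists mu,
  [/\ forall I, 0 <= mu I, moment mu =1 moment nu &
      forall lam, (forall I, 0 <= lam I) -> moment lam =1 moment nu ->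
        weight w mu <= weight w lam].
Proof.
move=> nu0; have key (l : seq {set V}) : exists mu,
    [/\ forall I, 0 <= mu I, moment mu =1 moment nu &
      forall lam, (forall I, 0 <= lam I) -> moment lam =1 moment nu -> independent lam ->
        supp lam \in l -> weight w mu <= weight w lam].
  elim: l => [|s l [mu [m1 m2 m3]]]; first by exists nu.
  case: (EM (exists lam, [/\ forall I, 0 <= lam I, moment lam =1 moment nu, independent lam,
     supp lam = s & weight w lam < weight w mu])) => [[mu' [h1 h2 h3 h4 h5]]|h].
    exists mu'; split=> // lam l1 l2 l3; rewrite inE => /orP[/eqP ls|]; last first.
      by move=> /(m3 _ l1 l2 l3); apply: le_trans; apply: ltW.
    rewrite le_eqVlt; apply/orP; left; apply/eqP; apply: eq_bigr => I _; congr (_ * _).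
    apply/eqP; rewrite -subr_eq0; apply/eqP; apply: (l3 (fun I => mu' I - lam I)) => [J|q].
      move=> lJ; have : J \notin s by rewrite -ls inE lJ eqxx.
      by rewrite -h4 inE negbK lJ => /eqP->; rewrite subrr.
    by rewrite momentB h2 l2 subrr.
  exists mu; split=> // lam l1 l2 l3; rewrite inE => /orP[/eqP ls|]; last exact: m3.
  by rewrite leNgt; apply/negP => lt; apply: h; exists lam.
have [mu [m1 m2 m3]] := key (enum {set V}); exists mu; split=> // lam l1 l2.
have [lam' [h1 h2 h3 h4]] := caratheodory l1; apply: le_trans h3; apply: m3 => //.
  by move=> q; rewrite h2 l2.
by rewrite mem_enum.
Qed.

Lemma minimal_carried mu : (forall I, 0 <= mu I) ->
  (forall lam, (forall I, 0 <= lam I) -> moment lam =1 moment mu -> weight w mu <= weight w lam) ->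
  carried comp mu.
Proof.
move=> mu0 mmin; apply: contrapT => /(swap_pair comp_refl comp_swap) [I [J [I' [J' [IJ hI hJ hm hw]]]]].
(* The largest amount of mass that both vertices can give up. *)
pose t := Num.min (mu I) (mu J); have t0 : 0 < t by rewrite lt_min hI hJ.
suff sh0 K : 0 <= shift mu t I J I' J' K by have := mmin _ sh0 (hm t); rewrite leNgt hw.
rewrite /shift; have tI : t <= mu I by rewrite ge_min lexx.
have tJ : t <= mu J by rewrite ge_min lexx orbT.
have a0 : 0 <= t * ((K == I')%:R + (K == J')%:R) by apply: mulr_ge0; [exact: ltW|rewrite addr_ge0 ?ler0n].
move: a0 (mu0 K); have [->|nI] /= := eqVneq K I; first by rewrite (negPf IJ) /=; lra.
by have [->|_] /= := eqVneq K J; lra.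
Qed.

Lemma carried_exists nu : (forall I, 0 <= nu I) -> exists mu,
  [/\ forall I, 0 <= mu I, moment mu =1 moment nu & carried comp mu].
Proof.
move=> /minimal_exists [mu [m1 m2 m3]]; exists mu; split=> //.
by apply: minimal_carried => // lam l1 l2; apply: m3 => // q; rewrite l2.
Qed.

(** A minimizer is carried, hence equals [mu] by uniqueness; [nu] is then a minimizer too, so the
    same argument applies to it. *)
Lemma carried_strict_min mu nu : exchange_free comp -> (forall I, 0 <= mu I) ->
  (forall I, 0 <= nu I) -> carried comp mu -> moment nu =1 moment mu ->
  weight w nu <= weight w mu -> nu =1 mu.
Proof.
move=> hX m0 n0 cm e le; have [mu' [m1 m2 m3]] := minimal_exists m0.
have c' : carried comp mu'.
  by apply: minimal_carried => // lam l1 l2; apply: m3 => // q; rewrite l2.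
have eq' : mu' =1 mu by apply: (carried_unique hX).
have ew : weight w mu' = weight w mu by apply: eq_bigr => I _; rewrite eq'.
apply: (carried_unique hX) => //; apply: minimal_carried => // lam l1 l2.
by apply: le_trans le _; rewrite -ew; apply: m3 => // q; rewrite l2 e.
Qed.
End Minimal.

(** * Farkas lemma by Fourier-Motzkin elimination *)

Section FourierMotzkin.
Variable F : realFieldType.
Local Open Scope ring_scope.

(* [((a, b), s)] stands for the constraint [a.x < b] if [s], and [a.x <= b] otherwise. *)
Definition constraint := ((nat -> F) * F * bool)%type.

Definition lhs d (a x : nat -> F) : F := \sum_(i < d) a i * x i.

Definition less (s : bool) (x y : F) := if s then x < y else x <= y.

Definition sat d (c : constraint) x := less c.2 (lhs d c.1.1 x) c.1.2.

(** [K] is an invariant of derived constraints; a later choice of [K] records the multipliers of the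
    derivation. *)
Definition cone_closed (K : constraint -> Prop) := [/\ K (fun _ => 0, 0, false),
  forall a b s a' b' s', K (a, b, s) -> K (a', b', s') ->
    K (fun i => a i + a' i, b + b', s || s') &
  forall t a b s, 0 < t -> K (a, b, s) -> K (fun i => t * a i, t * b, s)].

(** Take the midpoint of the greatest lower bound and the least upper bound, or a point one unit
    beyond if one kind of bound is missing. *)
Lemma less_between (T : finType) (lo up s : pred T) (f : T -> F) :
  (forall i j, up i -> lo j -> less (s i || s j) (f j) (f i)) ->
  exists t, (forall i, up i -> less (s i) t (f i)) /\ (forall j, lo j -> less (s j) (f j) t).
Proof.
move=> h; case: (pickP up) => [i1 u1|nou]; case: (pickP lo) => [j1 l1|nol].
- case: (@arg_minP _ _ _ i1 up f u1) => i ui imin.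
  case: (@arg_maxP _ _ _ j1 lo f l1) => j lj jmax.
  have ij := h i j ui lj; exists ((f i + f j) / 2); split.
    move=> i' ui'; have := imin i' ui'; have := h i' j ui' lj.
    move: ij; rewrite /less; case: (s i'); case: (s i); case: (s j) => /=; lra.
  move=> j' lj'; have := jmax j' lj'; have := h i j' ui lj'.
  move: ij; rewrite /less; case: (s j'); case: (s i); case: (s j) => /=; lra.
- case: (@arg_minP _ _ _ i1 up f u1) => i ui imin; exists (f i - 1); split.
    by move=> i' ui'; have := imin i' ui'; rewrite /less; case: (s i'); lra.
  by move=> j; rewrite nol.
- case: (@arg_maxP _ _ _ j1 lo f l1) => j lj jmax; exists (f j + 1); split.
    by move=> i; rewrite nou.
  by move=> j' lj'; have := jmax j' lj'; rewrite /less; case: (s j') => /=; lra.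
- by exists 0; split=> [i|j]; rewrite ?nou ?nol.
Qed.

(** Induction on the number of variables, eliminating variable [d]. The invariant passed on, [K'],
    also requires its coefficient to vanish. *)
Lemma fourier_motzkin d (T : finType) (c : T -> constraint) (K : constraint -> Prop) :
  cone_closed K -> (forall i, K (c i)) ->
  (exists x, forall i, sat d (c i) x) \/
  exists a b s, [/\ K (a, b, s), forall i, (i < d)%N -> a i = 0 & ~~ less s 0 b].
Proof.
elim: d T c K => [|d IH] T c K hK cK.
  case: (EM (exists i, ~~ less (c i).2 0 (c i).1.2)) => [[i hi]|h].
    by right; exists (c i).1.1, (c i).1.2, (c i).2; split=> //; case: (c i) (cK i) => -[].
  left; exists (fun _ => 0) => i; rewrite /sat /lhs big_ord0.
  by apply: contrapT => /negP hi; apply: h; exists i.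
case: (hK) => K0 KD KZ; pose al i := (c i).1.1 d.
pose K' (e : constraint) := K e /\ e.1.1 d = 0.
have hK' : cone_closed K'.
  split=> [//|a b s a' b' s' [h1 /= e1] [h2 /= e2]|t a b s t0 [h1 /= e1]]; split=> /=.
  - exact: KD.
  - by rewrite e1 e2 addr0.
  - exact: KZ.
  - by rewrite e1 mulr0.
pose combo i j : constraint := (fun m => (al i)^-1 * (c i).1.1 m + (- al j)^-1 * (c j).1.1 m,
  (al i)^-1 * (c i).1.2 + (- al j)^-1 * (c j).1.2, (c i).2 || (c j).2).
(* Constraints free of variable [d] are kept, an upper bound is combined with a lower bound so that
   [d] cancels, and other pairs become the trivial constraint [0 <= 0]. *)
pose c' (ij : T * T) : constraint :=
  if al ij.1 == 0 then c ij.1 else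
  if (0 < al ij.1) && (al ij.2 < 0) then combo ij.1 ij.2 else (fun _ => 0, 0, false).
have c'K ij : K' (c' ij).
  rewrite /c'; case: eqP => [//|_]; case: ifP => [/andP[p1 p2]|_]; last by split.
  split=> /=; last by rewrite -!/(al _); field; rewrite lt_eqF ?gt_eqF.
  have cE i : c i = ((c i).1.1, (c i).1.2, (c i).2) by case: (c i) => -[].
  apply: KD; apply: KZ; rewrite ?invr_gt0 ?oppr_gt0 //.
    by have := cK ij.1; rewrite {1}cE.
  by have := cK ij.2; rewrite {1}cE.
case: (IH _ c' K' hK' c'K) => [[x hx]|[a [b [s [[h1 h2] h3 h4]]]]]; last first.
  right; exists a, b, s; split=> // i; rewrite ltnS leq_eqVlt => /orP[/eqP->//|].
  exact: h3.
left; pose f i := ((c i).1.2 - lhs d (c i).1.1 x) / al i.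
have lhs_lin (t u : F) a a' : lhs d (fun m => t * a m + u * a' m) x = t * lhs d a x + u * lhs d a' x.
  by rewrite /lhs !mulr_sumr -big_split; apply: eq_bigr => m _ /=; ring.
have [|t [tu tl]] :=
    @less_between T (fun i => al i < 0) (fun i => 0 < al i) (fun i => (c i).2) f.
  move=> i j pi nj; have := hx (i, j).
  rewrite /c' /= gt_eqF // pi nj /sat /combo /= lhs_lin /f /less.
  set bi := (c i).1.2; set bj := (c j).1.2; set li := lhs _ _ _; set lj := lhs _ _ _.
  have -> : (bj - lj) / al j = (- al j)^-1 * lj - (- al j)^-1 * bj.
    by field; rewrite lt_eqF.
  have -> : (bi - li) / al i = (al i)^-1 * bi - (al i)^-1 * li by field; rewrite gt_eqF.
  by case: ifP => _; lra.
exists (fun m => if m == d then t else x m) => i.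
have e : lhs d.+1 (c i).1.1 (fun m => if m == d then t else x m) =
    lhs d (c i).1.1 x + al i * t.
  rewrite /lhs big_ord_recr /= eqxx; congr (_ + _); apply: eq_bigr => m _.
  by rewrite ltn_eqF.
rewrite /sat e; have := tu i; have := tl i; rewrite /f.
case: (ltgtP (al i) 0) => ai.
- move=> /(_ isT) + _; rewrite /less; case: ifP => _.
    by rewrite ltr_ndivrMr //; lra.
  by rewrite ler_ndivrMr //; lra.
- move=> _ /(_ isT); rewrite /less; case: ifP => _.
    by rewrite ltr_pdivlMr //; lra.
  by rewrite ler_pdivlMr //; lra.
- move=> _ _; rewrite ai mul0r addr0; have := hx (i, i).
  by rewrite /c' /= ai eqxx.
Qed.
End FourierMotzkin.

(** * Supporting hyperplanes *)

Section Regularity.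
Variables (F : realFieldType) (k n : nat).
Local Notation V := (Vkn k n).
Local Notation P := (Pkn k n).
Implicit Types (I J : V) (lam mu nu : V -> F) (s : {set V}) (c : option P -> F).
Variables (comp : rel V) (w : V -> int).
Hypothesis comp_exchange : exchange_free comp.
Hypothesis comp_refl : reflexive comp.
Hypothesis comp_swap : swappable comp w.
Local Open Scope ring_scope.

Definition affine c I : F := \sum_q c q * hom F I q.

Definition supporting c s := forall I, affine c I <= (w I)%:~R /\
  (I \in s <-> affine c I = (w I)%:~R).

Lemma carried_clique s lam : clique comp s -> (forall I, I \notin s -> lam I = 0) ->
  carried comp lam.
Proof.
move=> /cliqueP cs l0 I J lI lJ; apply: cs; apply: contraTT isT => /l0 e.
  by rewrite e ltxx in lI.
by rewrite e ltxx in lJ.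
Qed.

(** Positive and negative parts of [lam] are both carried and have equal moments, so they
    coincide. *)
Lemma clique_independent s lam : clique comp s -> (forall I, I \notin s -> lam I = 0) ->
  (forall q, moment lam q = 0) -> forall I, lam I = 0.
Proof.
move=> cs l0 lm I; pose p J := Num.max (lam J) 0; pose m J := Num.max (- lam J) 0.
have pm J : lam J = p J - m J by rewrite /p /m /Num.max; do !case: ifP => ?; lra.
have : p =1 m.
  apply: (carried_unique comp_exchange) => [J|J|||q].
  - by rewrite le_max lexx orbT.
  - by rewrite le_max lexx orbT.
  - by apply: (carried_clique cs) => J /l0 e; rewrite /p e maxxx.
  - by apply: (carried_clique cs) => J /l0 e; rewrite /m e oppr0 maxxx.
  - by apply/eqP; rewrite -subr_eq0 -momentB -(eq_moment pm) lm.
by rewrite pm => ->; rewrite subrr.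
Qed.

(** Swapping an incompatible pair on the hyperplane keeps the sum of the affine values and lowers
    the lifted sum, so a lifted point would fall below the hyperplane. *)
Lemma supporting_clique c s : supporting c s -> clique comp s.
Proof.
move=> sup; apply/cliqueP => I J Is Js; apply: contrapT => /negP nIJ.
have [I' [J' [hp hw]]] := comp_swap nIJ.
have e : affine c I + affine c J = affine c I' + affine c J'.
  rewrite /affine -!big_split; apply: eq_bigr => q _ /=; rewrite -!mulrDr; congr (_ * _).
  by case: q => //= p; rewrite -!natrD hp.
have [_ [/(_ Is) eI _]] := sup I; have [_ [/(_ Js) eJ _]] := sup J.
have [lI _] := sup I'; have [lJ _] := sup J'.
have : ((w I' + w J')%:~R : F) < (w I + w J)%:~R by rewrite ltr_int.
by rewrite !intrD -eI -eJ; lra.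
Qed.

(** If no hyperplane exists, Farkas multipliers [mu] have zero moments and nonpositive weight; a
    small multiple of [mu] added to the indicator of [s] contradicts strict minimality of that
    indicator. *)
Lemma clique_supporting s : clique comp s -> exists c, supporting c s.
Proof.
move=> cs; pose d := #|{: option P}|.
pose row I (m : nat) : F := 
    if (insub m : option 'I_d) is Some i then hom F I (enum_val i) else 0.
have rowE I (i : 'I_d) : row I i = hom F I (enum_val i) by rewrite /row valK.
have lhsE I x : lhs d (row I) x = affine (fun q => x (enum_rank q)) I.
  rewrite /affine /lhs (reindex _ (onW_bij _ (@enum_val_bij (option P)))) /=.
  by apply: eq_bigr => i _; rewrite rowE enum_valK mulrC.
pose W I : F := (w I)%:~R.
(* Equality on [s] is encoded as two weak inequalities, told apart by the boolean; off [s] the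
   inequality is strict. *)
pose con (T : V * bool) : constraint F := let: (J, b) := T in
  if J \in s then if b then (row J, W J, false) else (fun m => -1 * row J m, -1 * W J, false)
  else (row J, W J, true).
(* Multipliers may have any sign on [s]; a strict constraint requires a positive one off [s]. *)
pose K (e : constraint F) := exists mu : V -> F, [/\ forall I, I \notin s -> 0 <= mu I,
  forall m, e.1.1 m = \sum_I mu I * row I m, e.1.2 = weight w mu &
  e.2 -> exists2 I, I \notin s & 0 < mu I].
have hK : cone_closed K.
  split=> [|a b st a' b' st' [mu [/= h1 h2 h3 h4]] [mu' [/= h1' h2' h3' h4']]|t a b st t0 [mu [/= h1 h2 h3 h4]]].
  - exists (fun _ => 0); split=> //= [m|]; first by rewrite big1 // => I _; rewrite mul0r.
    by rewrite /weight big1 // => I _; rewrite mul0r.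
  - exists (fun I => mu I + mu' I); split=> /= [I Is|m||].
    + by rewrite addr_ge0 ?h1 ?h1'.
    + by rewrite h2 h2' -big_split; apply: eq_bigr => I _; rewrite mulrDl.
    + by rewrite weightD -h3 -h3'.
    + case/orP => [/h4|/h4'] [I Is mI]; exists I => //.
        by rewrite ltr_wpDr ?h1'.
      by rewrite ltr_wpDl ?h1.
  - exists (fun I => t * mu I); split=> /= [I Is|m||].
    + by rewrite mulr_ge0 ?h1 // ltW.
    + by rewrite h2 mulr_sumr; apply: eq_bigr => I _; rewrite mulrA.
    + by rewrite weightZ -h3.
    + by case/h4 => I Is mI; exists I => //; rewrite mulr_gt0.
have delta (x : V -> F) I : \sum_J (J == I)%:R * x J = x I.
  by rewrite (bigD1 I) //= eqxx mul1r big1 ?addr0 // => J /negPf->; rewrite mul0r.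
have conK i : K (con i).
  case: i => I b; rewrite /con; case: ifP => Is; first case: b.
  - exists (fun J => (J == I)%:R); split=> //= [m|].
    + by rewrite (delta (row^~ m)).
    + by rewrite /weight delta.
  - exists (fun J => -1 * (J == I)%:R); split=> //= [J Js|m|].
    + by case: eqVneq Js => [->|_ _]; rewrite ?Is ?mulr0.
    + by rewrite -(delta (row^~ m)) mulr_sumr; apply: eq_bigr => J _; rewrite mulrA.
    + by rewrite weightZ /weight delta.
  - exists (fun J => (J == I)%:R); split=> //= [m||_].
    + by rewrite (delta (row^~ m)).
    + by rewrite /weight delta.
    + by exists I; rewrite ?Is // eqxx.
case: (fourier_motzkin d hK conK) => [[x hx]|[a [b [st [[mu [m1 m2 m3 m4]] a0 hb]]]]].
  exists (fun q => x (enum_rank q)) => I; rewrite -lhsE.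
  have := hx (I, true); have := hx (I, false); rewrite /con /sat; case: ifP => Is; rewrite /less /=.
    have -> : lhs d (fun m => -1 * row I m) x = - lhs d (row I) x.
      by rewrite /lhs -sumrN; apply: eq_bigr => i _; rewrite mulN1r mulNr.
    by rewrite /W => h1 h2; split=> //; split=> // _; apply/eqP; rewrite eq_le h2 /=; lra.
  by move=> _ h; split; [exact: ltW|split=> // e; rewrite /W e ltxx in h].
exfalso; rewrite /= in m2 m3 m4.
have mom0 q : moment mu q = 0.
  have := a0 (enum_rank q) (ltn_ord _); rewrite m2 => <-.
  by apply: eq_bigr => I _; rewrite rowE enum_rankK.
have b0 : b <= 0 by move: hb; rewrite /less; case: st m4 => _; [rewrite -leNgt|rewrite -ltNge => /ltW].
(* Small enough for [1 + t * mu I] to be nonnegative at each vertex of [s]. *)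
pose t := (1 + \sum_I `|mu I|)^-1.
have S0 : 0 <= \sum_I `|mu I| by apply: sumr_ge0.
have t0 : 0 < t by rewrite invr_gt0; lra.
pose one I : F := (I \in s)%:R; pose nu I := one I + t * mu I.
have : nu =1 one.
  apply: (carried_strict_min comp_refl comp_swap comp_exchange) => [I|I||q|].
  - exact: ler0n.
  - rewrite /nu /one; case: (boolP (I \in s)) => Is; last first.
      by rewrite add0r mulr_ge0 ?m1 // ltW.
    have : `|t * mu I| <= 1.
      rewrite normrM gtr0_norm // /t ler_pdivrMl; last lra.
      by rewrite mulr1 (bigD1 I) //= addrCA lerDl addr_ge0 // sumr_ge0.
    by rewrite ler_norml => /andP[h _]; rewrite /=; lra.
  - by apply: (carried_clique cs) => I /negPf h; rewrite /one h.
  - by rewrite momentD momentZ mom0 mulr0 addr0.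
  - by rewrite weightD weightZ -m3 gerDl; apply: mulr_ge0_le0 => //; apply: ltW.
move=> e; have mu0 I : mu I = 0.
  have := e I; rewrite /nu => /eqP; rewrite -subr_eq0 addrAC subrr add0r mulf_eq0.
  by rewrite gt_eqF //= => /eqP.
have bE : b = 0 by rewrite m3 /weight big1 // => I _; rewrite mu0 mul0r.
move: hb; rewrite bE /less; case: st m4 => [/(_ isT) [I _]|]; last by rewrite lexx.
by rewrite mu0 ltxx.
Qed.

Hypothesis kn : (k <= n)%N.

(** The principal filter at [p], and the same filter without [p]. *)
Lemma unit_difference (p : P) : exists U U' : V,
  forall q, (chib U q = chib U' q + (q == p) :> nat)%N.
Proof.
case: p => a b.
have [||U hU] := @vertex_of_filter k n kn (fun q => (q.1 <= a)%N && (b <= q.2)%N).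
- by move=> a1 b1 b2 /= ->; lia.
- by move=> a1 b1 b2 /= ->; lia.
have [||U' hU'] := @vertex_of_filter k n kn
    (fun q => [&& (q.1 <= a)%N, (b <= q.2)%N & ~~ ((q.1 == a :> nat) && (q.2 == b :> nat))]).
- by move=> a1 b1 b2 /= ->; lia.
- by move=> a1 b1 b2 /= ->; lia.
exists U, U' => -[a1 b1]; rewrite hU hU' xpair_eqE -!val_eqE /=.
by lia.
Qed.

(** Unit differences recover the coordinates in [P], and the vertex with zero coordinates recovers
    the constant term. *)
Lemma affine_eq0 c : (forall I, affine c I = 0) -> forall q, c q = 0.
Proof.
move=> h [p|].
  have [U [U' hU]] := unit_difference p.
  have : affine c U - affine c U' = c (Some p).
    rewrite /affine -sumrB (bigD1 (Some p)) //= big1 ?addr0.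
      by rewrite /= hU eqxx natrD /=; ring.
    case=> [q|] qp; last by rewrite subrr.
    have /negPf ne : q != p by apply: contraNneq qp => ->.
    by rewrite /= hU ne addn0 subrr.
  by rewrite !h subrr.
have [||I hI] := @vertex_of_filter k n kn pred0; [by []|by []|].
have := h I; rewrite /affine (bigD1 None) //= mulr1 big1 ?addr0 //.
by case=> [p|] // _; rewrite /= hI mulr0.
Qed.

(* If [d] vanishes on [s], tilting the supporting hyperplane of [s] along [d] until it hits
   a further lifted point gives a larger face. *)
Lemma maximal_spanning s d : is_maximal_face (clique comp) s ->
  (forall I, I \in s -> affine d I = 0) -> forall q, d q = 0.
Proof.
move=> [cs smax] ds; apply: affine_eq0.
have affineD c c' t I : affine (fun q => c q + t * c' q) I = affine c I + t * affine c' I.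
  by rewrite /affine mulr_sumr -big_split; apply: eq_bigr => q _ /=; rewrite mulrDl mulrA.
have [c sup] := clique_supporting cs.
suff key e : (forall I, I \in s -> affine e I = 0) -> forall I, affine e I <= 0.
  move=> I; apply/eqP; rewrite eq_le key //=.
  have := key (fun q => 0 + -1 * d q) _ I; rewrite affineD mulN1r.
  have -> : affine (fun _ => 0) I = 0 by rewrite /affine big1 // => q _; rewrite mul0r.
  rewrite add0r oppr_le0; apply=> J Js; rewrite affineD ds //.
  by rewrite /affine big1 ?mulr0 ?addr0 // => q _; rewrite mul0r.
move=> es I; rewrite leNgt; apply/negP => eI.
pose sl J := (w J)%:~R - affine c J.
case: (@arg_minP _ _ _ I (fun J => 0 < affine e J) (fun J => sl J / affine e J) eI) => I1 eI1 I1min.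
set t := _ / _ in I1min.
have t0 : 0 <= t by apply: divr_ge0; [rewrite subr_ge0; have [] := sup I1|exact: ltW].
pose c' q := c q + t * e q; pose s' := [set J | affine c' J == (w J)%:~R].
have sup' : supporting c' s'.
  move=> J; split; last by rewrite inE; split => [/eqP|->].
  rewrite affineD; have [eJ|eJ] := ltP 0 (affine e J).
    by have := I1min J eJ; rewrite ler_pdivlMr // /sl; lra.
  by have [h _] := sup J; have := mulr_ge0_le0 t0 eJ; lra.
have ss' : s \subset s'.
  apply/subsetP => J Js; rewrite inE affineD es // mulr0 addr0.
  by have [_ [/(_ Js) -> _]] := sup J.
have I1s : I1 \in s'.
  by rewrite inE affineD /t (divfK (lt0r_neq0 eI1)) /sl addrC subrK.
rewrite (smax _ (supporting_clique sup') ss') in I1s.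
by rewrite es // ltxx in eI1.
Qed.

(** The matrix of homogenized vertices of [s] has independent rows because [s] is a face, and
    independent columns because [s] is maximal; so it is square and invertible. *)
Lemma maximal_basis s : is_maximal_face (clique comp) s ->
  #|s| = #|P|.+1 /\ forall u, exists r : V -> F,
    (forall I, I \notin s -> r I = 0) /\ forall q, moment r q = hom F u q.
Proof.
move=> smax; have [cs _] := smax.
pose H : 'M[F]_(#|s|, #|{: option P}|) := \matrix_(i, j) hom F (enum_val i) (enum_val j).
pose ext (v : 'rV[F]_#|s|) I := \sum_i v 0 i * (I == enum_val i)%:R.
have ext0 v I : I \notin s -> ext v I = 0.
  move=> Is; rewrite /ext big1 // => i _; case: eqVneq => [e|_]; last by rewrite mulr0.
  by rewrite e enum_valP in Is.
have extv v i : ext v (enum_val i) = v 0 i.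
  rewrite /ext (bigD1 i) //= eqxx mulr1 big1 ?addr0 // => j ji.
  by rewrite (inj_eq enum_val_inj) eq_sym (negPf ji) mulr0.
have extm v j : moment (ext v) (enum_val j) = (v *m H) 0 j.
  rewrite mxE /moment (bigID (mem s)) /= [X in _ + X]big1 ?addr0; last first.
    by move=> I /ext0->; rewrite mul0r.
  by rewrite big_enum_val; apply: eq_bigr => i _; rewrite extv mxE.
have free : row_free H.
  apply: inj_row_free => v vH; apply/rowP => i; rewrite mxE -extv.
  apply: (clique_independent cs); first exact: ext0.
  by move=> q; rewrite -(enum_rankK q) extm vH mxE.
have full : row_free H^T.
  apply: inj_row_free => v vH; apply/rowP => j; rewrite mxE.
  pose d q := v 0 (enum_rank q).
  have := @maximal_spanning s d smax _ (enum_val j); rewrite /d enum_valK; apply=> I Is.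
  have := congr1 (fun A : 'rV[F]_#|s| => A 0 (enum_rank_in Is I)) vH.
  rewrite !mxE => <-; rewrite /affine (reindex _ (onW_bij _ (@enum_val_bij (option P)))) /=.
  by apply: eq_bigr => i _; rewrite /d enum_valK !mxE enum_rankK_in.
have es : #|s| = #|{: option P}|.
  by move: free full; rewrite /row_free mxrank_tr => /eqP h1 /eqP h2; exact: etrans (esym h1) h2.
split; first by rewrite es card_option.
move=> u; have rf : row_full H by move: full; rewrite /row_free mxrank_tr.
have /submxP [v hv] : (\row_j hom F u (enum_val j) <= H)%MS by apply: submx_full.
exists (ext v); split; first exact: ext0.
by move=> q; rewrite -(enum_rankK q) extm -hv mxE.
Qed.
End Regularity.

(** * The triangulation *)

Section Unimodularity.
Variables k n : nat.
Hypothesis kn : (k <= n)%N.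
Local Notation V := (Vkn k n).
Local Notation P := (Pkn k n).
Implicit Types (I u : V) (s : {set V}).
Local Open Scope ring_scope.

(* Adding a large multiple of the sum of the vertices of [s] to [u] gives a point in the cone
   over [s]; it is a sum of vertices, hence has an integral noncrossing decomposition, which
   must agree with the one over [s]. *)
Lemma maximal_integral_basis s u : is_maximal_face (NC k n) s -> exists z : V -> int,
  (forall I, I \notin s -> z I = 0) /\
  forall q, \sum_I (z I)%:~R * hom rat I q = hom rat u q.
Proof.
move=> smax; have [cs _] := smax.
have [_ /(_ u) [r [r0 rm]]] := maximal_basis rat (@noncrossing_exchange_free k n)
  (@noncrossing_refl k n) (@noncrossing_swappable k n) kn smax.
(* A common bound for the [r I], so that adding [M] on [s] makes all coefficients nonnegative. *)
pose M := (\sum_I Num.bound (r I))%N.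
have rM I : `|r I| <= M%:R.
  apply: le_trans (ltW (archi_boundP (normr_ge0 _))) _.
  have -> : Num.bound `|r I| = Num.bound (r I).
    by rewrite /Num.bound normr_id.
  by rewrite ler_nat /M (bigD1 I) //= leq_addr.
pose g I : nat := (M * (I \in s) + (I == u))%N.
pose N := (\sum_I g I)%N.
have gN I : (g I <= N)%N by rewrite /N (bigD1 I) //= leq_addr.
pose m : {ffun V -> 'I_N.+1} := [ffun I => inord (g I)].
have mE I : m I = g I :> nat by rewrite ffunE inordK // ltnS.
have mN : (\sum_I m I = N)%N by apply: eq_bigr => I _; rewrite mE.
have [m' [_ hm' cm']] := carried_mset rat (@noncrossing_refl k n) (@noncrossing_swappable k n) mN.
pose lam I : rat := M%:R * (I \in s)%:R + r I.
have e : mset_fun rat m' =1 lam.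
  apply: (carried_unique (@noncrossing_exchange_free k n)) => // [I||q].
  - rewrite /lam; case: (boolP (I \in s)) => [_|/r0 ->]; last by rewrite addr0 mulr_ge0 ?ler0n.
    by have := rM I; rewrite ler_norml => /andP[h _]; rewrite mulr1 -lerBlDl sub0r.
  - by apply: (carried_clique cs) => I Is; rewrite /lam (negPf Is) mulr0 add0r r0.
  - rewrite hm' momentD rm -moment_delta -momentD; apply: eq_moment => I.
    by rewrite /mset_fun /= mE /g natrD natrM.
exists (fun I => (m' I)%:Z - (M * (I \in s))%:Z); split=> [I Is|q].
  have := e I; rewrite /mset_fun /lam /= r0 // addr0 -natrM => /eqP; rewrite eqr_nat => /eqP ->.
  by rewrite subrr.
rewrite -rm; apply: eq_bigr => I _; congr (_ * _).
have := e I; rewrite /mset_fun /lam /= => eI; rewrite intrB -!pmulrn eI natrM.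
by rewrite addrAC subrr add0r.
Qed.

(** Integral expansions of the unit vectors in the vertices of [s] give an integral left inverse of
    [M], so its determinant divides 1. *)
Lemma unimodular_NC : is_unimodular (NC k n).
Proof.
move=> s smax; have [es _] := maximal_basis rat (@noncrossing_exchange_free k n)
  (@noncrossing_refl k n) (@noncrossing_swappable k n) kn smax.
pose f (i : 'I_#|P|.+1) : V := enum_val (cast_ord (esym es) i).
have finj : injective f by move=> i j /enum_val_inj/cast_ord_inj.
have sE : s = [set f i | i in 'I_#|P|.+1].
  apply/setP => I; apply/idP/imsetP => [Is|[i _ ->]]; last exact: enum_valP.
  exists (cast_ord es (enum_rank_in Is I)) => //.
  by rewrite /f cast_ordK enum_rankK_in.
exists f; split=> //; split=> //=; set M := (\matrix_(i, j) _)%R.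
have sum_s (z g : V -> int) : (forall I, I \notin s -> z I = 0) ->
    \sum_I z I * g I = \sum_i z (f i) * g (f i).
  move=> z0; rewrite (bigID (mem s)) /= [X in _ + X]big1 ?addr0; last first.
    by move=> I /z0->; rewrite mul0r.
  by rewrite {1}sE big_imset //= => x y _ _; apply: finj.
have /choice [z hz] : forall p : P, exists z : V -> int, [/\ forall I, I \notin s -> z I = 0,
    \sum_I z I = 0 & forall q, \sum_I z I * chiZ I q = (q == p)%:Z].
  move=> p; have [U [U' hU]] := unit_difference kn p.
  have [z [z0 zm]] := maximal_integral_basis U smax.
  have [z' [z0' zm']] := maximal_integral_basis U' smax.
  have zz q : \sum_I (z I - z' I)%:~R * hom rat I q = hom rat U q - hom rat U' q.
    rewrite -zm -zm' -sumrB; apply: eq_bigr => I _.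
    by rewrite intrB mulrBl.
  exists (fun I => z I - z' I); split=> [I Is||q]; first by rewrite z0 ?z0' ?subrr.
    have := zz None; rewrite subrr; under eq_bigr do rewrite mulr1.
    by rewrite -raddf_sum /= => /eqP; rewrite intr_eq0 => /eqP.
  apply: (@intr_inj rat); rewrite raddf_sum /=.
  have := zz (Some q); rewrite /= hU natrD addrAC subrr add0r => h.
  rewrite -[RHS]/((q == p)%:R) -h; apply: eq_bigr => I _.
  by rewrite intrM /chiZ.
pose L : 'M[int]_#|P| := \matrix_(i, j) z (enum_val i) (f (lift ord0 j)).
(* The coefficients of each expansion sum to zero, so subtracting the base vertex [f ord0] changes
   nothing and its term drops out. *)
have LM : L *m M = 1%:M.
  apply/matrixP => p q; rewrite !mxE; have [z0 zs zq] := hz (enum_val p).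
  transitivity (\sum_i z (enum_val p) (f i) *
      (chiZ (f i) (enum_val q) - chiZ (f ord0) (enum_val q))).
    rewrite big_ord_recl subrr mulr0 add0r; apply: eq_bigr => i _.
    by rewrite !mxE.
  rewrite -(@sum_s (z (enum_val p)) (fun I => chiZ I (enum_val q) - chiZ (f ord0) (enum_val q))) //.
  under eq_bigr do rewrite mulrBr.
  rewrite sumrB -mulr_suml zs mul0r subr0 zq (inj_eq enum_val_inj) eq_sym.
  by case: (p == q).
have : \det L * \det M = 1 by rewrite -det_mulmx LM det1.
move=> /(congr1 absz); rewrite abszM => /eqP; rewrite muln_eq1 => /andP[_ /eqP h].
by case: (\det M) h => -[|[|m]] //=; [left|right].
Qed.
End Unimodularity.

Section Triangulation.
Variables k n : nat.
Hypothesis kn : (k <= n)%N.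
Local Notation V := (Vkn k n).
Local Notation P := (Pkn k n).
Local Notation R := Rdefinitions.R.
Implicit Types (I J : V) (s t : {set V}) (lam : V -> R).
Local Open Scope ring_scope.

Lemma chiRE I p : chiR k n I p = hom R I (Some p).
Proof. by rewrite /chiR /hom; case: chib. Qed.

Lemma rsum_chiR lam p : rsum (fun I => Rmult (lam I) (chiR k n I p)) = moment lam (Some p).
Proof. by apply: eq_bigr => I _; rewrite chiRE. Qed.

Lemma rsum_moment lam : rsum lam = moment lam None.
Proof. by rewrite moment_total. Qed.

Lemma in_convP s x : in_conv (chiR k n) s x <-> exists lam, [/\ forall I, 0 <= lam I,
  forall I, I \notin s -> lam I = 0, moment lam None = 1 & forall p, moment lam (Some p) = x p].
Proof.
split=> [[lam [l0 [ls [l1 lp]]]]|[lam [l0 ls l1 lp]]]; exists lam.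
  split=> //; first by move=> I; apply/RleP/l0.
    by rewrite -rsum_moment l1.
  by move=> p; rewrite -rsum_chiR lp.
split; first by move=> I; apply/RleP/l0.
split=> //; split; first by rewrite rsum_moment l1.
by move=> p; rewrite rsum_chiR lp.
Qed.

Lemma order_polytopeP x : order_polytope k n x <-> monotone x /\ forall p, 0 <= x p <= 1.
Proof.
split=> [[h1 [h2 h3]]|[[h2 h3] h1]].
  split; last by move=> p; have [a b] := h1 p; apply/andP; split; apply/RleP.
  by split=> [a b b' e|a a' b e]; apply/RleP; [apply: h2|apply: h3].
split; first by move=> p; have /andP[/RleP a /RleP b] := h1 p.
by split=> [a b b' e|a a' b e]; apply/RleP; [apply: h2|apply: h3].
Qed.

(** Layer cake followed by minimization. The mass [c] is arbitrary because the study of the link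
    needs the whole cone. *)
Lemma carried_cover (y : P -> R) c : monotone y -> (forall p, 0 <= y p <= c) -> 0 <= c ->
  exists lam, [/\ forall I, 0 <= lam I, moment lam None = c,
    forall p, moment lam (Some p) = y p & carried (@noncrossing k n) lam].
Proof.
move=> ym yc c0; have [nu [n0 nN nS]] := layer_cake kn ym yc c0.
have [mu [m0 me mc]] := carried_exists (@noncrossing_refl k n) (@noncrossing_swappable k n) n0.
by exists mu; split=> // [|p]; rewrite me.
Qed.

Lemma triangulation_NC : is_triangulation (chiR k n) (NC k n) (order_polytope k n).
Proof.
have uniq := carried_unique (@noncrossing_exchange_free k n).
split; [|split; [|split]].
- move=> s cs lam l0 l1 lp; apply: (clique_independent (@noncrossing_exchange_free k n) cs) => //.
  by case=> [p|]; rewrite -?rsum_chiR -?rsum_moment.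
- move=> s x _ /in_convP [lam [l0 ls l1 lp]]; apply/order_polytopeP.
  have mono p q : (forall I, chib I p -> chib I q) -> x p <= x q.
    move=> h; rewrite -!lp; apply: ler_sum => I _; apply: ler_wpM2l => //=.
    by rewrite ler_nat; have := h I; case: chib => //= ->.
  split; first split=> [a b b' e|a a' b e].
  + by rewrite /= in e; apply: mono => I; rewrite !chibE; lia.
  + have aa : (a < a')%N by rewrite -[nat_of_ord a']/(val a') e.
    apply: mono => I; rewrite !chibE; have := ent_mono I aa; rewrite /= in e; lia.
  + move=> p; rewrite -lp; apply/andP; split.
      by apply: sumr_ge0 => I _; rewrite mulr_ge0 ?ler0n.
    rewrite -l1; apply: ler_sum => I _; apply: ler_wpM2l => //=.
    by rewrite lern1 leq_b1.
- move=> x /order_polytopeP [xm xb]; have [lam [l0 l1 lp lc]] := carried_cover xm xb ler01.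
  exists [set I | 0 < lam I]; split.
    by apply/cliqueP => I J; rewrite !inE; apply: lc.
  apply/in_convP; exists lam; split=> // I; rewrite inE -leNgt => h.
  by apply/eqP; rewrite eq_le h l0.
- move=> s t x cs ct /in_convP [lam [l0 ls l1 lp]] /in_convP [mu [m0 ms m1 mp]].
  (* Uniqueness makes both coefficient vectors equal, hence supported on [s :&: t]. *)
  have e : lam =1 mu.
    apply: uniq => //; [exact: carried_clique ls|exact: carried_clique ms|].
    by case=> [p|]; rewrite ?lp ?mp ?l1 ?m1.
  apply/in_convP; exists lam; split=> // I; rewrite inE negb_and => /orP[/ls//|/ms].
  by rewrite e.
Qed.

Lemma regular_NC : is_regular (chiR k n) (NC k n).
Proof.
exists (fun I => (nc_weight I)%:~R : R) => s.
have affE (c : P -> R) (c0 : R) I : Rplus c0 (rsum (fun p => Rmult (c p) (chiR k n I p))) =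
    affine (fun q => if q is Some p then c p else c0) I.
  rewrite /affine (bigD1 None) //= mulr1; congr (_ + _).
  rewrite (reindex_omap (@Some P) (fun q => q)) /=; last by case.
  apply: eq_big => [p|p _]; first by rewrite eqxx.
  by rewrite chiRE.
split=> [cs|[c [c0 hc]]].
  have [c sup] := clique_supporting R (@noncrossing_exchange_free k n)
    (@noncrossing_refl k n) (@noncrossing_swappable k n) cs.
  exists (fun p => c (Some p)), (c None) => I; rewrite affE.
  have -> : affine (fun q => if q is Some p then c (Some p) else c None) I = affine c I.
    by apply: eq_bigr => -[].
  by have [h1 h2] := sup I; split=> //; apply/RleP.
apply: (supporting_clique (@noncrossing_swappable k n)
  (c := fun q => if q is Some p then c p else c0)).
by move=> I; have [/RleP] := hc I; rewrite affE.
Qed.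

Lemma complex_NC : is_simplicial_complex_on (NC k n).
Proof.
split=> [s t /subsetP ts /cliqueP cs|I].
  by apply/cliqueP => I J It Jt; apply: cs; apply: ts.
by apply/cliqueP => J K /set1P-> /set1P->; apply: noncrossing_refl.
Qed.

Lemma flag_NC : is_flag (NC k n).
Proof.
move=> s; split=> [/cliqueP cs I J Is Js|h].
  by apply/cliqueP => K L /set2P[] -> /set2P[] ->; apply: cs.
apply/cliqueP => I J Is Js; have /cliqueP := h I J Is Js.
by apply; rewrite !inE eqxx ?orbT.
Qed.
End Triangulation.

(** * The link of the simplex of cyclic intervals *)

Section Cyclic.
Variables k n : nat.
Hypothesis kn : (k <= n)%N.
Local Notation V := (Vkn k n).
Local Notation P := (Pkn k n).
Implicit Types (I J : V).

Lemma noncrossing_sym I J : noncrossing I J = noncrossing J I.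
Proof.
by apply/noncrossingP/noncrossingP => h a b ab e; rewrite andbC; apply: h => // l /e.
Qed.

(* The [k]-subsets of [n] that are intervals in the cyclic order. *)
Definition cyclic I : bool :=
  [exists j : 'I_(n - k).+1, [forall a, ent I a == a + j]] ||
  [exists c : 'I_k.+1, [forall a, ent I a == (if a < c then a : nat else n - k + a)]].

(** If [I] is consecutive from [a] to [b], the agreement strictly between squeezes [J] to
    [ent J a <= ent I a] and [ent I b <= ent J b], or else [b = a + 1] leaves no room. If [I] jumps
    between them, [ent I a] is least possible and [ent I b] greatest possible. *)
Lemma cyclic_noncrossing I J : cyclic I -> noncrossing I J.
Proof.
move=> cI; apply/noncrossingP => a b ab agree.
have cons : (forall l : 'I_k, a <= l <= b -> ent I l = ent I a + (l - a)) ->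
    ~~ ((ent I a < ent J a < ent I b) && (ent I b < ent J b)) &&
    ~~ ((ent J a < ent I a < ent J b) && (ent J b < ent I b)).
  move=> cons; have eb := cons b; have [ab1|ab1] := eqVneq (b : nat) a.+1.
    by have := eb _; rewrite ab1 leqnn leqnSn => /(_ isT); lia.
  have ha : a.+1 < k by have := ltn_ord b; lia.
  have hb : b.-1 < k by have := ltn_ord b; lia.
  have := agree (Ordinal ha); have := agree (Ordinal hb).
  have := cons (Ordinal ha); have := cons (Ordinal hb).
  have := @ent_mono _ _ J a (Ordinal ha); have := @ent_mono _ _ J (Ordinal hb) b.
  by move: eb; rewrite /=; lia.
case/orP: cI => /existsP[j /forallP hj].
  by apply: cons => l /andP[al lb]; rewrite !(eqP (hj _)); lia.
have := hj a; have := hj b; case: ifP => bj; case: ifP => aj.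
- by move=> _ _; apply: cons => l lab; rewrite !(eqP (hj _)) aj; case: ifP; lia.
- by lia.
- by move=> /eqP eb /eqP ea; have := ent_ge J a; have := ent_le J b; lia.
- by move=> _ _; apply: cons => l lab; rewrite !(eqP (hj _)) aj; case: ifP; lia.
Qed.

(** Capping [c] at [k] provides a vertex for every natural number, so that a choice function on
    [nat] exists. *)
Lemma row_vertex (c : nat) : exists I, cyclic I /\
  forall (a : 'I_k) (b : 'I_(n - k)), chib I (a, b) = (a < c).
Proof.
have [||I hI] := @vector_of k n (fun a => if a < minn c k then a : nat else n - k + a).
- by move=> a; have := ltn_ord a; case: ifP; lia.
- by move=> a b ab; case: ifP; case: ifP; lia.
exists I; split.
  have hc : minn c k < k.+1 by lia.
  apply/orP; right; apply/existsP; exists (Ordinal hc); apply/forallP => a.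
  by rewrite hI.
by move=> a b; rewrite chibE hI; have := ltn_ord a; have := ltn_ord b; case: ifP; lia.
Qed.

Lemma column_vertex (j : nat) : exists I, cyclic I /\
  forall (a : 'I_k) (b : 'I_(n - k)), chib I (a, b) = (j <= b).
Proof.
have [||I hI] := @vector_of k n (fun a => a + minn j (n - k)).
- by move=> a; have := ltn_ord a; lia.
- by move=> a b ab; lia.
exists I; split.
  have hj : minn j (n - k) < (n - k).+1 by lia.
  apply/orP; left; apply/existsP; exists (Ordinal hj); apply/forallP => a.
  by rewrite hI.
by move=> a b; rewrite chibE hI; have := ltn_ord b; lia.
Qed.

Lemma cyclic_chib I : cyclic I ->
  (forall (a : 'I_k) b b', chib I (a, b) = chib I (a, b')) \/
  (forall a a' (b : 'I_(n - k)), chib I (a, b) = chib I (a', b)).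
Proof.
case/orP => /existsP[j /forallP hj]; [right|left].
  by move=> a a' b; rewrite !chibE !(eqP (hj _)) !leq_add2l.
move=> a b b'; rewrite !chibE !(eqP (hj _)).
by have := ltn_ord b; have := ltn_ord b'; case: ifP; lia.
Qed.
End Cyclic.

(** * The mixed second difference on the cone over the link *)

Section MixedDifference.
Variables (k n : nat).
Hypothesis kn : (k <= n)%N.
Local Notation V := (Vkn k n).
Local Notation P := (Pkn k n).
Local Notation R := Rdefinitions.R.
Local Notation M := ('I_k.-1 * 'I_(n - k).-1)%type.
Variables (a0 : 'I_k) (b0 : 'I_(n - k)).
Implicit Types (I J : V) (lam mu : V -> R) (y : P -> R).
Local Open Scope ring_scope.

(** Natural indices allow successors without bound proofs; out of range they fall back to [a0] and
    [b0]. *)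
Definition at_pos y (i j : nat) : R := y (insubd a0 i, insubd b0 j).

Lemma at_posE y (a : 'I_k) (b : 'I_(n - k)) : at_pos y a b = y (a, b).
Proof. by rewrite /at_pos !valKd. Qed.

Definition mixed_diff y (q : M) : R :=
  at_pos y q.1 q.2 - at_pos y q.1 q.2.+1 - at_pos y q.1.+1 q.2 + at_pos y q.1.+1 q.2.+1.

Lemma row_lt (i : 'I_k.-1) : (i.+1 < k)%N.
Proof. by have := ltn_ord i; lia. Qed.

Lemma col_lt (j : 'I_(n - k).-1) : (j.+1 < n - k)%N.
Proof. by have := ltn_ord j; lia. Qed.

Lemma at_pos_fun (f : nat -> nat -> R) i j : (i < k)%N -> (j < n - k)%N ->
  at_pos (fun p => f p.1 p.2) i j = f i j.
Proof. by move=> hi hj; rewrite /at_pos /= !val_insubd hi hj. Qed.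

Lemma mixed_diff_fun (f : nat -> nat -> R) q : mixed_diff (fun p => f p.1 p.2) q =
  f q.1 q.2 - f q.1 q.2.+1 - f q.1.+1 q.2 + f q.1.+1 q.2.+1.
Proof.
have := row_lt q.1; have := col_lt q.2 => h1 h2.
by rewrite /mixed_diff !at_pos_fun // ltnW.
Qed.

(** Quantitative form of the kernel being the functions [r a + s b]: the mixed differences are
    telescoped first along columns, then along rows. *)
Lemma mixed_diff_bound y eta : 0 <= eta -> (forall q, `|mixed_diff y q| <= eta) ->
  forall (a : 'I_k) (b : 'I_(n - k)),
  `|y (a, b) - (at_pos y a 0 + at_pos y 0 b - at_pos y 0 0)| <= (k * n)%:R * eta.
Proof.
move=> eta0 h a b.
have step i j : (i.+1 < k)%N -> (j < n - k)%N ->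
   `|at_pos y i.+1 j - at_pos y i j - at_pos y i.+1 0 + at_pos y i 0| <= j%:R * eta.
  move=> hi; elim: j => [_|j IH hj].
    by rewrite mul0r normr_le0; apply/eqP; ring.
  have hi' : (i < k.-1)%N by lia.
  have hj' : (j < (n - k).-1)%N by lia.
  have := h (Ordinal hi', Ordinal hj'); have := IH (ltnW hj); rewrite /mixed_diff /=.
  rewrite !ler_norml => /andP[h1 h2] /andP[h3 h4].
  by rewrite -natr1 mulrDl mul1r; apply/andP; split; lra.
have total i : (i < k)%N ->
    `|at_pos y i b - (at_pos y i 0 + at_pos y 0 b - at_pos y 0 0)| <= (i * n)%:R * eta.
  elim: i => [_|i IH hi].
    by rewrite mul0n mul0r normr_le0; apply/eqP; ring.
  have := step _ _ hi (ltn_ord b); have := IH (ltnW hi).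
  have bn : b%:R * eta <= n%:R * eta.
    by apply: ler_wpM2r => //; rewrite ler_nat; have := ltn_ord b; lia.
  rewrite mulSn natrD mulrDl !ler_norml => /andP[h1 h2] /andP[h3 h4].
  by apply/andP; split; lra.
rewrite -(at_posE y a b); apply: le_trans (total a (ltn_ord a)) _.
by apply: ler_wpM2r => //; rewrite ler_nat leq_mul2r ltnW ?orbT.
Qed.

Definition Phi lam : M -> R := mixed_diff (fun p => moment lam (Some p)).

Lemma PhiZ c lam q : Phi (fun I => c * lam I) q = c * Phi lam q.
Proof. by rewrite /Phi /mixed_diff /at_pos !momentZ; ring. Qed.

Lemma Phi_sum lam q : Phi lam q = \sum_I lam I * mixed_diff (fun p => hom R I (Some p)) q.
Proof.
rewrite /Phi /mixed_diff /at_pos /moment -!sumrB -big_split.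
by apply: eq_bigr => I _ /=; ring.
Qed.

Lemma cyclic_mixed_diff I q : cyclic I -> mixed_diff (fun p => hom R I (Some p)) q = 0.
Proof.
move=> /(cyclic_chib kn) []h; rewrite /mixed_diff /at_pos /=.
  by rewrite !(h _ (insubd b0 q.2.+1) (insubd b0 q.2)); ring.
by rewrite !(h (insubd a0 q.1.+1) (insubd a0 q.1)); ring.
Qed.

(* The points of the cone over the link of the simplex of cyclic intervals. *)
Definition link_point lam := [/\ forall I, 0 <= lam I, forall I, cyclic I -> lam I = 0 &
  carried (@noncrossing k n) lam].

Lemma Phi_onto (u : M -> R) : exists lam, link_point lam /\ Phi lam =1 u.
Proof.
pose y (i j : nat) : R := \sum_q u q * ((q.1 < i)%N && (q.2 < j)%N)%:R.
pose S : R := \sum_q `|u q|; have S0 : 0 <= S by apply: sumr_ge0.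
have yS i j : `|y i j| <= S.
  apply: le_trans (ler_norm_sum _ _ _) _; apply: ler_sum => q _.
  by rewrite normrM; case: (_ && _); rewrite ?normr1 ?mulr1 // normr0 mulr0.
(* The slope [T] beats the variation of [y] between neighbours; [K] and [c] are the resulting shift
   and upper bound. *)
pose T := 2 * S; pose K := S + T * k%:R; pose c := S + T * n%:R + K.
pose Y (i j : nat) := y i j + T * j%:R - T * i%:R + K.
have T0 : 0 <= T by rewrite /T; lra.
have step (i : nat) : i.+1%:R = i%:R + 1 :> R by rewrite -addn1 natrD.
have [||| lam [l0 _ lp lc]] := @carried_cover k n kn (fun p => Y p.1 p.2) c.
- split=> [a b b' /= e|a a' b /= e]; rewrite /Y e step.
    by have := yS a b; have := yS a b.+1; rewrite !ler_norml => /andP[? ?] /andP[? ?]; rewrite /T; lra.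
  by have := yS a b; have := yS a.+1 b; rewrite !ler_norml => /andP[? ?] /andP[? ?]; rewrite /T; lra.
- move=> [a b] /=; rewrite /Y /c /K; have := yS a b; rewrite ler_norml => /andP[h1 h2].
  have ha : T * a%:R <= T * k%:R by apply: ler_wpM2l => //; rewrite ler_nat ltnW.
  have hb : T * b%:R <= T * n%:R.
    by apply: ler_wpM2l => //; rewrite ler_nat; have := ltn_ord b; lia.
  have ha0 : 0 <= T * a%:R by rewrite mulr_ge0.
  have hb0 : 0 <= T * b%:R by rewrite mulr_ge0.
  by apply/andP; split; lra.
- have : 0 <= T * k%:R by rewrite mulr_ge0.
  have : 0 <= T * n%:R by rewrite mulr_ge0.
  by rewrite /c /K; lra.
exists (fun I => if cyclic I then 0 else lam I); split.
  split=> [I|I ->//|I J]; first by case: ifP.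
  by case: ifP => _; rewrite ?ltxx //; case: ifP => _; rewrite ?ltxx //; apply: lc.
move=> q; transitivity (Phi lam q).
  rewrite !Phi_sum; apply: eq_bigr => I _; case: ifP => // cI.
  by rewrite cyclic_mixed_diff // !mulr0.
have -> : Phi lam q = mixed_diff (fun p => Y p.1 p.2) q.
  by rewrite /Phi /mixed_diff /at_pos !lp.
rewrite mixed_diff_fun /Y !step.
transitivity (y q.1 q.2 - y q.1 q.2.+1 - y q.1.+1 q.2 + y q.1.+1 q.2.+1); first ring.
rewrite /y -!sumrB -big_split (bigD1 q) //= big1 ?addr0.
  by rewrite !ltnn !ltnSn /=; ring.
move=> r rq.
have [e|e] : ((r.1 < q.1.+1) = (r.1 < q.1))%N \/ ((r.2 < q.2.+1) = (r.2 < q.2))%N.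
- case: r q rq => r1 r2 [q1 q2]; rewrite xpair_eqE negb_and -!val_eqE /=.
  by case/orP => h; [left|right]; lia.
- by rewrite e; ring.
- by rewrite e; ring.
Qed.

(** Differences of successive row or column vertices are indicators of one row or column with total
    mass zero; [X 0] has zero coordinates and adjusts the mass. *)
Lemma cyclic_span (r : 'I_k -> R) (s : 'I_(n - k) -> R) (T : R) : exists tau : V -> R,
  [/\ forall I, ~~ cyclic I -> tau I = 0, moment tau None = T &
      forall a b, moment tau (Some (a, b)) = r a + s b].
Proof.
have /choice [X hX] := row_vertex kn; have /choice [Y hY] := column_vertex kn.
pose row (a : 'I_k) I : R := (I == X a.+1)%:R - (I == X a)%:R.
pose col (b : 'I_(n - k)) I : R := (I == Y b)%:R - (I == Y b.+1)%:R.
pose tau I := \sum_a r a * row a I + \sum_b s b * col b I + T * (I == X 0%N)%:R.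
have tauE q : moment tau q = \sum_a r a * (hom R (X a.+1) q - hom R (X a) q) +
    \sum_b s b * (hom R (Y b) q - hom R (Y b.+1) q) + T * hom R (X 0%N) q.
  rewrite 2!momentD !moment_sum momentZ moment_delta; congr (_ + _ + _);
    by apply: eq_bigr => a _; rewrite momentB !moment_delta.
exists tau; split.
- move=> I nI; have ne J : cyclic J -> (I == J) = false.
    by move=> cJ; apply/negbTE; apply: contraNneq nI => ->.
  rewrite /tau !big1 => [|b _|a _]; last 2 first.
  + by rewrite /col !ne ?subrr ?mulr0 //; exact: (hY _).1.
  + by rewrite /row !ne ?subrr ?mulr0 //; exact: (hX _).1.
  by rewrite ne ?mulr0 ?addr0 //; exact: (hX _).1.
- rewrite tauE !big1 /= => [|b _|a _]; rewrite ?subrr ?mulr0 //; ring.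
- move=> a b; rewrite tauE /= (hX _).2 ltn0 mulr0 addr0; congr (_ + _).
    rewrite (bigD1 a) //= big1 ?addr0.
      by rewrite !(hX _).2 ltnSn ltnn /=; ring.
    move=> a' ne; rewrite !(hX _).2 (_ : (a < a'.+1)%N = (a < a')%N) ?subrr ?mulr0 //.
    by move: ne; rewrite -val_eqE /=; lia.
  rewrite (bigD1 b) //= big1 ?addr0.
    by rewrite !(hY _).2 leqnn ltnn /=; ring.
  move=> b' ne; rewrite !(hY _).2 (_ : (b' < b)%N = (b' <= b)%N) ?subrr ?mulr0 //.
  by move: ne; rewrite -val_eqE /=; lia.
Qed.

(** Up to a small error the moments differ by those of a combination [tau] of cyclic vertices. Its
    negative part is added to [lam] and its positive part to [mu]; both stay carried, so
    [carried_lipschitz] applies, and noncyclic coefficients have not changed. *)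
Lemma Phi_lipschitz : exists2 C : R, 0 <= C & forall lam mu eta, link_point lam ->
  link_point mu -> 0 <= eta -> (forall q, `|Phi lam q - Phi mu q| <= eta) ->
  forall I, `|lam I - mu I| <= C * eta.
Proof.
have [C C0 hC] := carried_lipschitz R (@noncrossing_exchange_free k n).
exists (C * (k * n)%:R); first by rewrite mulr_ge0.
move=> lam mu eta [l0 lc lN] [m0 mc mN] eta0 h I.
pose x p := moment lam (Some p) - moment mu (Some p).
have xd q : `|mixed_diff x q| <= eta.
  apply: le_trans (h q); rewrite /Phi /mixed_diff /x /at_pos le_eqVlt; apply/orP; left.
  by apply/eqP; congr `|_|; ring.
have xb := mixed_diff_bound eta0 xd.
have [tau [t0 tN tS]] := cyclic_span (fun a => at_pos x a 0)
  (fun b => at_pos x 0 b - at_pos x 0 0) (moment lam None - moment mu None).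
pose lam' I := lam I + Num.max (- tau I) 0; pose mu' I := mu I + Num.max (tau I) 0.
have car f g : carried (@noncrossing k n) f -> (forall I, ~~ cyclic I -> g I = 0) ->
    carried (@noncrossing k n) (fun I => f I + g I).
  move=> cf g0 J K hJ hK; case: (boolP (cyclic J)) => cJ; first exact: cyclic_noncrossing.
  case: (boolP (cyclic K)) => cK; first by rewrite noncrossing_sym; apply: cyclic_noncrossing.
  by apply: cf; [move: hJ|move: hK]; rewrite g0 ?addr0.
have e J : lam' J - mu' J = lam J - mu J - tau J.
  by rewrite /lam' /mu' /Num.max; do !case: ifP => ?; lra.
have nr : near (@noncrossing k n) lam' mu' ((k * n)%:R * eta).
  split.
  - by move=> J; rewrite addr_ge0 // le_max lexx orbT.
  - by move=> J; rewrite addr_ge0 // le_max lexx orbT.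
  - by apply: car => // J /t0 ->; rewrite oppr0 maxxx.
  - by apply: car => // J /t0 ->; rewrite maxxx.
  - move=> q; rewrite -momentB (eq_moment e) !momentB; case: q => [[a b]|].
      by rewrite tS addrA; exact: xb.
    by rewrite tN subrr normr0 mulr_ge0.
have := hC _ _ _ nr I; rewrite e mulrA; case: (boolP (cyclic I)) => cI.
  by move=> _; rewrite lc // mc // subrr normr0 mulr_ge0 // mulr_ge0.
by rewrite t0 // subr0.
Qed.
End MixedDifference.

(** * Continuity for the sup-distance *)

Section Continuity.
Local Notation R := Rdefinitions.R.
Local Open Scope ring_scope.

Lemma rdist_ge (T : finType) (x y : T -> R) i : `|x i - y i| <= rdist x y.
Proof.
rewrite /rdist; have : i \in index_enum T by apply: mem_index_enum.
elim: index_enum => // j r IH; rewrite inE big_cons -RabsE => /orP[/eqP->|/IH h].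
  exact/RleP/Rmax_l.
by apply: le_trans h _; apply/RleP/Rmax_r.
Qed.

Lemma rdist_lt (T : finType) (x y : T -> R) eps : 0 < eps ->
  (forall i, `|x i - y i| < eps) -> rdist x y < eps.
Proof.
move=> e0 h; apply: (big_ind (fun z : R => z < eps)) => //.
  by move=> a b /RltP ha /RltP hb; apply/RltP/Rmax_lub_lt.
by move=> i _; rewrite RabsE; apply: h.
Qed.

Lemma rdist_ge0 (T : finType) (x y : T -> R) : 0 <= rdist x y.
Proof.
apply: (big_ind (fun z : R => 0 <= z)) => //.
  by move=> a b /RleP ha _; apply/RleP; apply: Rle_trans ha (Rmax_l _ _).
by move=> i _; rewrite RabsE.
Qed.

Variable T : finType.
Variable X : (T -> R) -> Prop.

Definition cont (h : (T -> R) -> R) := forall x, X x -> forall eps, 0 < eps ->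
  exists2 delta, 0 < delta & forall y, X y -> rdist x y < delta -> `|h x - h y| < eps.

Lemma cont_lipschitz C h : (forall x y, X x -> X y -> `|h x - h y| <= C * rdist x y) -> cont h.
Proof.
move=> hC x Xx eps e0; exists (eps / (1 + `|C|)) => [|y Xy].
  by rewrite divr_gt0 // ltr_pwDl.
rewrite ltr_pdivlMr ?ltr_pwDl // => lt; apply: le_lt_trans (hC x y Xx Xy) _.
apply: le_lt_trans lt; rewrite mulrC; apply: ler_wpM2l; first exact: rdist_ge0.
by apply: le_trans (ler_norm C) _; rewrite lerDr.
Qed.

Lemma cont_coord i : cont (fun x => x i).
Proof. by apply: (@cont_lipschitz 1) => x y _ _; rewrite mul1r; apply: rdist_ge. Qed.

Lemma cont_add f g : cont f -> cont g -> cont (fun x => f x + g x).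
Proof.
move=> cf cg x Xx eps e0; have e2 : 0 < eps / 2 by lra.
have [d d0 hd] := cf x Xx _ e2; have [d' d'0 hd'] := cg x Xx _ e2.
exists (Num.min d d') => [|y Xy]; first by rewrite lt_min d0 d'0.
rewrite lt_min => /andP[/(hd y Xy) h1 /(hd' y Xy) h2].
have -> : f x + g x - (f y + g y) = (f x - f y) + (g x - g y) by ring.
by apply: le_lt_trans (ler_normD _ _) _; lra.
Qed.

Lemma cont_comp (phi : R -> R) f : cont f -> (forall x, X x -> continuity_pt phi (f x)) ->
  cont (fun x => phi (f x)).
Proof.
move=> cf cphi x Xx eps e0.
have [a [a0 ha]] := cphi x Xx eps (RltP e0).
have [d d0 hd] := cf x Xx a (introT RltP a0); exists d => // y Xy xy.
have [->|ne] := eqVneq (f y) (f x); first by rewrite subrr normr0.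
rewrite distrC -RabsE; apply/RltP/ha; split; first by split=> // /esym/eqP; rewrite (negPf ne).
by apply/RltP; rewrite /= /Rdist RabsE distrC; apply: hd.
Qed.

Lemma cont_scale c f : cont f -> cont (fun x => f x * c).
Proof.
move=> cf; apply: (cont_comp (phi := fun t => t * c)) => // x _.
by apply: derivable_continuous_pt; apply: (derivable_pt_mult (fun t => t) (fun _ => c));
  [apply: derivable_pt_id|apply: derivable_pt_const].
Qed.

Lemma cont_sqr f : cont f -> cont (fun x => f x * f x).
Proof.
move=> cf; apply: (cont_comp (phi := Rsqr)) => // x _.
by apply: derivable_continuous_pt; apply: derivable_pt_Rsqr.
Qed.

Lemma cont_sum (I : finType) (f : I -> (T -> R) -> R) : (forall i, cont (f i)) ->
  cont (fun x => \sum_i f i x).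
Proof.
move=> cf; elim: (index_enum I) => [|i r IH] x Xx eps e0.
  by exists 1 => // y _ _; rewrite !big_nil subrr normr0.
have [d d0 hd] := cont_add (cf i) IH Xx e0; exists d => // y Xy /(hd y Xy).
by rewrite !big_cons.
Qed.

Lemma cont_div f g : cont f -> cont g -> (forall x, X x -> g x != 0) ->
  cont (fun x => f x / g x).
Proof.
move=> cf cg g0; pose gi x := (g x)^-1.
have cgi : cont gi.
  apply: (cont_comp (phi := fun t => t^-1)) => // x Xx.
  have -> : (fun t : R => t^-1) = Rinv by apply/funext => t; rewrite RinvE.
  apply: (continuity_pt_inv (fun t => t)); last by apply/eqP/g0.
  exact: derivable_continuous_pt (derivable_pt_id _).
(* Polarization writes the product of [f] and [gi] through squares. *)
have h : cont (fun x => ((f x + gi x) * (f x + gi x) + ((f x * -1 + gi x) * (f x * -1 + gi x)) * -1) * (4^-1)).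
  apply: cont_scale; apply: cont_add.
    by apply: cont_sqr; apply: cont_add.
  apply: cont_scale; apply: cont_sqr; apply: cont_add => //; exact: cont_scale.
move=> x Xx eps e0; have [d d0 hd] := h x Xx eps e0; exists d => // y Xy /(hd y Xy).
congr (`|_ - _| < _); rewrite /gi; field; rewrite ?g0 //.
Qed.

Lemma continuous_onP (U : finType) (f : (T -> R) -> (U -> R)) :
  (forall i, cont (fun x => f x i)) -> continuous_on X f.
Proof.
move=> cf x Xx eps /RltP e0.
have /choice [d hd] : forall i, exists d : R, 0 < d /\
    forall y, X y -> rdist x y < d -> `|f x i - f y i| < eps.
  by move=> i; have [d d0 h] := cf i x Xx eps e0; exists d.
(* The inverse of [S] is a positive lower bound for all [d i], also when the index type is empty. *)
pose S : R := 1 + \sum_i (d i)^-1.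
have di0 i : 0 < (d i)^-1 by rewrite invr_gt0; case: (hd i).
have S0 : 0 < S by apply: ltr_pwDl => //; apply: sumr_ge0 => i _; apply: ltW.
have dS i : S^-1 <= d i.
  rewrite -[leRHS]invrK lef_pV2 ?posrE //; rewrite /S (bigD1 i) //= addrCA lerDl.
  by rewrite addr_ge0 // sumr_ge0 // => j _; apply: ltW.
exists S^-1; split; first by apply/RltP; rewrite invr_gt0.
move=> y Xy /RltP xy; apply/RltP; apply: rdist_lt => // i.
by have [_ h] := hd i; apply: h => //; apply: lt_le_trans xy (dS i).
Qed.
End Continuity.

(** * The link as a sphere, and the join decomposition *)

Section Gorenstein.
Variables (k n : nat).
Hypothesis kn : (k <= n)%N.
Local Notation V := (Vkn k n).
Local Notation R := Rdefinitions.R.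
Local Notation M := ('I_k.-1 * 'I_(n - k).-1)%type.
Variables (a0 : 'I_k) (b0 : 'I_(n - k)).
Implicit Types (I J : V) (lam mu : V -> R) (s t r : {set V}).
Local Open Scope ring_scope.

Local Notation Phi := (@Phi k n a0 b0).
Local Notation link_point := (@link_point k n).

Definition cyclic_set : {set V} := [set I | cyclic I].

Definition link : complex V := fun r => NC k n r && [disjoint cyclic_set & r].

Lemma linkP r : reflect (clique (@noncrossing k n) r /\ forall I, I \in r -> ~~ cyclic I) (link r).
Proof.
apply: (iffP andP) => -[h1 h2]; split=> //.
  by move=> I Ir; have := disjointFl h2 Ir; rewrite inE => ->.
by rewrite disjoint_sym; apply/pred0P => I /=; apply/negP => /andP[/h2]; rewrite inE => /negPf->.
Qed.

Lemma realization_linkP lam : realization link lam <-> link_point lam /\ \sum_I lam I = 1.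
Proof.
split=> [[l0 [l1 [s [/linkP[cs ncs] ls]]]]|[[l0 lc lN] l1]].
  split=> //; split=> [I|I cI|]; first exact/RleP/l0.
    by apply: ls; apply/negP => /ncs; rewrite cI.
  exact: carried_clique ls.
split; first by move=> I; apply/RleP/l0.
split=> //; exists [set I | 0 < lam I]; split.
  apply/linkP; split; first by apply/cliqueP => I J; rewrite !inE; apply: lN.
  by move=> I; rewrite inE; apply: contraL => /lc ->; rewrite ltxx.
by move=> I; rewrite inE -leNgt => h; apply/eqP; rewrite eq_le h l0.
Qed.

Lemma Phi_injective lam mu : link_point lam -> link_point mu -> Phi lam =1 Phi mu -> lam =1 mu.
Proof.
move=> hl hm e I; have [C _ hC] := Phi_lipschitz kn a0 b0.
have := hC lam mu 0 hl hm (lexx 0) _ I; rewrite mulr0 normr_le0 subr_eq0 => /(_ _)/eqP; apply.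
by move=> q; rewrite e subrr normr0.
Qed.

Lemma link_pointZ c lam : 0 <= c -> link_point lam -> link_point (fun I => c * lam I).
Proof.
move=> c0 [l0 lc lN]; split=> [I|I /lc ->|I J hI hJ]; rewrite ?mulr0 //.
  exact: mulr_ge0.
have pos K : 0 < c * lam K -> 0 < lam K.
  by move=> h; rewrite lt_def l0 andbT; apply: contraTneq h => ->; rewrite mulr0 ltxx.
by apply: lN; apply: pos.
Qed.

Let m := #|{: M}|.

(** [Phi] has an inverse [Psi] on the cone. Dividing [Phi] by the Euclidean norm and [Psi] by the
    total mass gives mutually inverse maps, by homogeneity and injectivity of [Phi]. *)
Lemma link_sphere : homeomorphic (realization link) (@sphere m).
Proof.
have /choice [Psi hPsi] := Phi_onto kn a0 b0.
have PsiP u : link_point (Psi u) by have [] := hPsi u.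
have PhiK u : Phi (Psi u) =1 u by have [] := hPsi u.
have uniq lam u : link_point lam -> Phi lam =1 u -> Psi u =1 lam.
  by move=> hl e; apply: Phi_injective => // q; rewrite PhiK e.
have [C C0 hC] := Phi_lipschitz kn a0 b0.
pose ext (y : 'I_m -> R) (q : M) := y (enum_rank q).
pose f0 (x : V -> R) (i : 'I_m) : R := Phi x (enum_val i).
pose N2 x : R := \sum_i f0 x i * f0 x i.
pose N x := sqrt (N2 x).
pose S y : R := \sum_I Psi (ext y) I.
have zero_point : link_point (fun _ => 0) by split=> // I J; rewrite ltxx.
have Phi0 q : Phi (fun _ => 0) q = 0.
  by rewrite Phi_sum big1 // => I _; rewrite mul0r.
have N2_0 x : 0 <= N2 x by apply: sumr_ge0 => i _; rewrite -expr2 sqr_ge0.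
have N2_pos x : realization link x -> 0 < N2 x.
  move=> /realization_linkP [lx sx]; rewrite lt_def N2_0 andbT; apply/negP => /eqP h.
  have f0x i : f0 x i = 0.
    move/eqP: h; rewrite psumr_eq0 => [/allP/(_ i)|j _]; last by rewrite -expr2 sqr_ge0.
    by rewrite mem_index_enum /= mulf_eq0 orbb => /(_ isT)/eqP.
  have x0 : x =1 fun _ => 0.
    apply: Phi_injective => // q; rewrite Phi0 -(enum_rankK q); exact: f0x.
  move: sx; rewrite big1 => [/eqP|I _]; last exact: x0.
  by rewrite eq_sym oner_eq0.
have N_pos x : realization link x -> 0 < N x.
  by move=> /N2_pos /RltP h; apply/RltP/sqrt_lt_R0.
have N_sq x : N x * N x = N2 x by apply: sqrt_sqrt; apply/RleP.
have S_pos y : sphere y -> 0 < S y.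
  move=> sy; have [P0 _ _] := PsiP (ext y).
  have S0 : 0 <= S y by apply: sumr_ge0.
  rewrite lt_def S0 andbT; apply/negP => /eqP h.
  have P_0 : Psi (ext y) =1 fun _ => 0.
    move=> I; move/eqP: h; rewrite psumr_eq0 // => /allP/(_ I).
    by rewrite mem_index_enum /= => /(_ isT)/eqP.
  have y0 i : y i = 0.
    have := PhiK (ext y) (enum_val i); rewrite /ext enum_valK => <-.
    rewrite -(Phi0 (enum_val i)) !Phi_sum; apply: eq_bigr => I _; by rewrite P_0.
  move: sy; rewrite /sphere /rsum => /eqP; rewrite big1 => [|i _]; last by rewrite y0; exact: mul0r.
  by rewrite eq_sym oner_eq0.
pose f (x : V -> R) (i : 'I_m) := f0 x i / N x.
pose g (y : 'I_m -> R) I := Psi (ext y) I / S y.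
have gf x : realization link x -> g (f x) =1 x.
  move=> rx I; have [lx sx] := (realization_linkP x).1 rx; have Nx := N_pos _ rx.
  have e : Psi (ext (f x)) =1 fun J => (N x)^-1 * x J.
    apply: uniq; first by apply: link_pointZ => //; rewrite invr_ge0 ltW.
    by move=> q; rewrite PhiZ /ext /f /f0 enum_rankK mulrC.
  have -> : g (f x) I = (N x)^-1 * x I / ((N x)^-1 * \sum_J x J).
    rewrite /g e; congr (_ / _); rewrite /S mulr_sumr; apply: eq_bigr => J _; exact: e.
  by rewrite sx mulr1 invrK mulrC mulrA divff ?mul1r // gt_eqF.
have f0g y i : f0 (g y) i = (S y)^-1 * y i.
  rewrite /f0; have -> : Phi (g y) (enum_val i) = Phi (fun I => (S y)^-1 * Psi (ext y) I) (enum_val i).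
    by rewrite !Phi_sum; apply: eq_bigr => I _; rewrite /g [X in X * _]mulrC.
  by rewrite PhiZ PhiK /ext enum_valK.
exists f, g; split; [|split; [|split; [|split; [|split]]]].
- move=> x rx; have Nx := N_pos _ rx; rewrite /sphere.
  transitivity (N2 x / (N x * N x)); last by rewrite N_sq divff // gt_eqF // N2_pos.
  rewrite /N2 mulr_suml; apply: eq_bigr => i _.
  exact: mulf_div.
- move=> y sy; have Sy := S_pos _ sy; apply/realization_linkP; split.
    have := link_pointZ (_ : 0 <= (S y)^-1) (PsiP (ext y)); rewrite invr_ge0 ltW // => /(_ isT).
    by congr (link_point _); apply/funext => I; rewrite /g mulrC.
  by rewrite -mulr_suml divff // gt_eqF.
- exact: gf.
- move=> y sy i; have Sy := S_pos _ sy; rewrite /f f0g.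
  have N2g : N2 (g y) = (S y)^-1 * (S y)^-1.
    transitivity ((S y)^-1 * (S y)^-1 * \sum_i y i * y i); last first.
      by have -> : \sum_i y i * y i = 1 := sy; rewrite mulr1.
    by rewrite mulr_sumr; apply: eq_bigr => j _; rewrite !f0g mulrACA.
  have -> : N (g y) = (S y)^-1.
    rewrite /N N2g; apply: sqrt_square; apply/RleP; rewrite invr_ge0; exact: ltW.
  by rewrite invrK mulrC mulrA divff ?mul1r // gt_eqF.
- have cf0 i : cont (realization link) (fun x => f0 x i).
    have e x : f0 x i = \sum_I x I *
       mixed_diff a0 b0 (fun p => hom R I (Some p)) (enum_val i) by rewrite /f0 Phi_sum.
    have -> : (fun x => f0 x i) = (fun x => \sum_I x I *
       mixed_diff a0 b0 (fun p => hom R I (Some p)) (enum_val i)) by apply/funext.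
    by apply: cont_sum => I; apply: cont_scale; apply: cont_coord.
  apply: continuous_onP => i; apply: cont_div => // [|x rx]; last by rewrite gt_eqF // N_pos.
  apply: (cont_comp (phi := sqrt)) => [|x _].
    by apply: cont_sum => j; apply: cont_sqr.
  by apply: continuity_pt_sqrt; apply/RleP.
(* The Lipschitz bound for [Phi] on link points is a Lipschitz bound for the coordinates of
   [Psi]. *)
- have cPsi I : cont (@sphere m) (fun y => Psi (ext y) I).
    apply: (@cont_lipschitz _ _ C) => x y _ _; apply: hC => //; first exact: rdist_ge0.
    by move=> q; rewrite !PhiK; exact: (rdist_ge x y (enum_rank q)).
  apply: continuous_onP => I; apply: cont_div => // [|y sy]; last by rewrite gt_eqF // S_pos.
  by apply: cont_sum.
Qed.

(** A face splits into its cyclic and noncyclic vertices; conversely any cyclic vertices may be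
    added to a face of the link, being compatible with everything. *)
Lemma Gorenstein_NC : is_Gorenstein (NC k n).
Proof.
exists cyclic_set, link; split; [|split; [|split]].
- move=> s t /subsetP ts /linkP [cs ncs]; apply/linkP; split; last by move=> I /ts/ncs.
  by move/cliqueP: cs => cs; apply/cliqueP => I J /ts Is /ts Js; apply: cs.
- by move=> r /andP[].
- move=> s; split=> [/cliqueP cs|[t [r [/subsetP tA [/linkP[/cliqueP cr _] ->]]]]].
    exists (s :&: cyclic_set), (s :\: cyclic_set); split; first exact: subsetIr.
    split; last by rewrite setID.
    apply/linkP; split; last by move=> I; rewrite !inE => /andP[].
    by apply/cliqueP => I J /setDP[Is _] /setDP[Js _]; apply: cs.
  apply/cliqueP => I J; rewrite !inE.
  case: (boolP (cyclic I)) => cI; first by move=> _ _; apply: cyclic_noncrossing.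
  case: (boolP (cyclic J)) => cJ.
    by move=> _ _; rewrite noncrossing_sym; apply: cyclic_noncrossing.
  case/orP => [/tA|Ir]; first by rewrite inE (negPf cI).
  case/orP => [/tA|Jr]; first by rewrite inE (negPf cJ).
  exact: cr.
- by exists m; apply: link_sphere.
Qed.
End Gorenstein.

Theorem theorem1p4 (k n : nat) (hk1 : (1 <= k)%N) (hkn : (k <= n - 1)%N) :
  is_simplicial_complex_on (NC k n) /\
  is_flag (NC k n) /\
  is_triangulation (chiR k n) (NC k n) (order_polytope k n) /\
  is_regular (chiR k n) (NC k n) /\
  is_unimodular (NC k n) /\
  is_Gorenstein (NC k n) /\
  (forall i : nat, fvec (NC k n) i = fvec (NN k n) i) /\
  (forall j : nat, hvec (NC k n) j = hvec (NN k n) j).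
Proof.
have kn : (k <= n)%N by apply: leq_trans hkn (leq_subr _ _).
have nk : (0 < n - k)%N by move: hk1 hkn; lia.
split; first exact: complex_NC.
split; first exact: flag_NC.
split; first exact: triangulation_NC.
split; first exact: regular_NC.
split; first exact: unimodular_NC.
split; first exact: (Gorenstein_NC kn (Ordinal hk1) (Ordinal nk)).
by split; [exact: fvec_NC_NN|exact: hvec_NC_NN].
Qed.
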